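(* Let $E$ be a vector bundle over a smooth manifold $M$ and let $[\cdot,\cdot]$ be an $\mathbb{R}$-bilinear bracket operation on the $C^\infty(M)$-module $\mathcal{E}=\mathrm{Sec}(E)$ that satisfies the Jacobi identity $$[[X,Y],Z]=[X,[Y,Z]]-[Y,[X,Z]]\qquad (X,Y,Z\in\mathcal{E})$$ and that is a quasi-derivation with respect to both arguments (no skew-symmetry is assumed). (a) If $\mathrm{rank}(E)>1$, then there is a vector bundle morphism $a:E\to TM$ over the identity map on $M$ such that $a([X,Y])=[a(X),a(Y)]_{vf}$ and $$[fX,gY]=fg[X,Y]+f\,a(X)(g)\,Y-g\,a(Y)(f)\,X$$ for all $X,Y\in\mathcal{E}$, $f,g\in C^\infty(M)$. Moreover, $[X,Y](p)=-[Y,X](p)$ for all $X,Y\in\mathcal{E}$ at every $p\in M$ with $a_p\neq 0$. (b) If $\mathrm{rank}(E)=1$, then the bracket is skew-symmetric and defines a local Lie algebra structure which, locally, is equivalent to a Jacobi bracket, i.e. to a bracket of the form $$[f,g]=\Lambda(\mathrm{d}f,\mathrm{d}g)+f\,\Gamma(g)-g\,\Gamma(f).$$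
   Context: $\mathrm{Sec}(E)$ is the space of smooth sections of the real vector bundle $E$, whose fibers all have the same finite dimension $\mathrm{rank}(E)$. $[\cdot,\cdot]_{vf}$ is the Lie bracket of vector fields on $M$, and $a_p:E_p\to T_pM$ is the restriction of $a$ to the fiber at $p$. An $\mathbb{R}$-linear operator $D:\mathcal{E}\to\mathcal{E}$ is a quasi-derivation if for each $f\in C^\infty(M)$ there is $\widehat{D}(f)\in C^\infty(M)$ such that $D(fX)=fD(X)+\widehat{D}(f)X$ for all $X\in\mathcal{E}$. The bracket is a quasi-derivation with respect to both arguments if, for every fixed $X\in\mathcal{E}$, both operators $Y\mapsto[X,Y]$ and $Y\mapsto[Y,X]$ are quasi-derivations. A local Lie algebra (in the sense of Kirillov) on a line bundle $E$ is a real Lie algebra bracket on $\mathrm{Sec}(E)$ that is local, i.e. $\mathrm{supp}[X,Y]\subset\mathrm{supp}\,X\cap\mathrm{supp}\,Y$. A Jacobi bracket on a manifold $U$ is a bracket on $C^\infty(U)$ of the form $[f,g]=\Lambda(\mathrm{d}f,\mathrm{d}g)+f\Gamma(g)-g\Gamma(f)$, for a bivector field $\Lambda$ and a vector field $\Gamma$ on $U$, that satisfies the Jacobi identity. ''Locally equivalent to a Jacobi bracket'' means that over open sets $U\subset M$ on which $E$ is trivialized, under the induced identification $\mathrm{Sec}(E|_U)\cong C^\infty(U)$, the bracket becomes a Jacobi bracket. *)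

(* Defs.v *)
From HB Require Import structures.
From mathcomp Require Import all_boot all_order all_algebra.
From mathcomp Require Import all_classical all_reals all_analysis.

Set Implicit Arguments.
Unset Strict Implicit.
Unset Printing Implicit Defensive.

Import Order.TTheory GRing.Theory Num.Theory numFieldNormedType.Exports.
Local Open Scope classical_set_scope.
Local Open Scope ring_scope.

Section Smooth.
Context {R : realType}.

(* For an open set U: f is C^(k+1) on U when it is (Frechet-)differentiable on *)
(* U and all its directional derivatives x |-> df_x(v) are C^k on U.           *)
Fixpoint Ck (k : nat) {m : nat} {W : normedModType R} (U : set 'rV[R]_m)
    (f : 'rV[R]_m -> W) : Prop :=
  if k is k'.+1 then
    (forall x, U x -> differentiable f x) /\ (forall v, Ck k' U ('D_v f))
  else forall x, U x -> {for x, continuous f}.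

Definition smooth_on {m : nat} {W : normedModType R} (U : set 'rV[R]_m)
    (f : 'rV[R]_m -> W) : Prop := forall k, Ck k U f.

Lemma near_eq_differentiable (V W : normedModType R) (f g : V -> W) (x : V) :
  {near x, f =1 g} -> differentiable f x -> differentiable g x.
Proof.
move=> fg df; have [dfc dfE] := (diff_locallyP _ _).1 df.
have gE : g \o shift x = cst (g x) + 'd f x +o_ 0 id.
  apply/eqaddoP => e e0; move/eqaddoP : dfE => /(_ e e0) He.
  have fgx : f x = g x := nbhs_singleton fg.
  have : \forall y \near (0 : V), f (y + x) = g (y + x).
    have sx : (fun y : V => y + x) @ (0 : V) --> x.
      by rewrite -[X in _ --> X]add0r; apply: cvgD; [exact: cvg_id|exact: cvg_cst].
    exact: sx _ fg.
  move=> H; near=> y.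
  have -> : (g \o shift x - (cst (g x) + 'd f x)) y
     = (f \o shift x - (cst (f x) + 'd f x)) y.
    rewrite !fctE /= fgx; congr (_ - _); apply/esym; near: y; exact: H.
  by near: y.
apply/diff_locallyP; rewrite (diff_unique dfc gE); split => //.
Unshelve. all: by end_near. Qed.

Lemma CkW k m (W : normedModType R) (U : set 'rV[R]_m) (f : 'rV[R]_m -> W) :
  Ck k.+1 U f -> Ck k U f.
Proof.
elim: k f => [|k IH] f /=; first by move=> [df _] x Ux; exact/differentiable_continuous/df.
by move=> [df Df]; split=> // v; apply: IH; exact: Df.
Qed.

Lemma Ck_local k m (W : normedModType R) (U : set 'rV[R]_m) (f : 'rV[R]_m -> W) :
  (forall x, U x -> exists2 V, V x & Ck k V f) -> Ck k U f.
Proof.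
elim: k f => [|k IH] f /= H.
  by move=> x /H[V Vx]; exact.
split=> [x /H[V Vx []]|v]; first by move=> + _; exact.
by apply: IH => x /H[V Vx [_ Df]]; exists V.
Qed.

Lemma CkS k m (W : normedModType R) (U V : set 'rV[R]_m) (f : 'rV[R]_m -> W) :
  U `<=` V -> Ck k V f -> Ck k U f.
Proof. by move=> UV Vf; apply: Ck_local => x Ux; exists V => //; exact: UV. Qed.

Lemma near_open (T : topologicalType) (U : set T) (P : T -> Prop) x :
  open U -> U x -> (forall y, U y -> P y) -> \forall y \near x, P y.
Proof. by move=> oU Ux UP; apply: filterS (open_nbhs_nbhs (conj oU Ux)). Qed.

Lemma Ck_congr k m (W : normedModType R) (U : set 'rV[R]_m) (f g : 'rV[R]_m -> W) :
  open U -> (forall x, U x -> f x = g x) -> Ck k U f -> Ck k U g.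
Proof.
move=> oU; elim: k f g => [|k IH] f g fg.
  move=> /= cf x Ux A; rewrite -(fg x Ux) => nA.
  have fA : \forall y \near x, A (f y) := cf x Ux A nA.
  have fgA : \forall y \near x, A (f y) -> A (g y).
    by apply: (@near_open _ U _ x) => // y /fg <-.
  exact: filter_app fgA fA.
have nfg x : U x -> {near x, f =1 g}.
  by move=> Ux; apply: (@near_open _ U _ x).
move=> [df Df]; split => [x Ux|v].
  exact: near_eq_differentiable (nfg _ Ux) (df _ Ux).
by apply: IH (Df v) => x Ux; exact/near_eq_derive/nfg.
Qed.

Lemma Ck_cst k m (W : normedModType R) (U : set 'rV[R]_m) (w : W) :
  Ck k U (fun=> w : W).
Proof.
elim: k w => [|k IH] w /=; first by move=> x _; exact: cst_continuous.
split=> [x _|v]; first exact: differentiable_cst.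
suff -> : 'D_v (fun=> w) = (fun=> 0) by exact: IH.
by apply/funext => x; exact: derive_cst.
Qed.

Lemma Ck_add k m (W : normedModType R) (U : set 'rV[R]_m) (f g : 'rV[R]_m -> W) :
  open U -> Ck k U f -> Ck k U g -> Ck k U (f + g).
Proof.
move=> oU; elim: k f g => [|k IH] f g.
  by move=> cf cg x Ux; apply: continuousD; [exact: cf|exact: cg].
move=> [df Df] [dg Dg]; split=> [x Ux|v].
  by apply: differentiableD; [exact: (df x Ux)|exact: (dg x Ux)].
apply: (Ck_congr oU _ (IH _ _ (Df v) (Dg v))) => x Ux.
by rewrite deriveD //; apply: diff_derivable; [exact: df|exact: dg].
Qed.

Lemma Ck_mul k m (U : set 'rV[R]_m) (f g : 'rV[R]_m -> R) :
  open U -> Ck k U f -> Ck k U g -> Ck k U (f * g).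
Proof.
move=> oU; elim: k f g => [|k IH] f g.
  by move=> cf cg x Ux; apply: continuousM; [exact: cf|exact: cg].
move=> Cf Cg; have := (Cf, Cg) => -[[df Df] [dg Dg]]; split=> [x Ux|v].
  by apply: differentiableM; [exact: (df x Ux)|exact: (dg x Ux)].
have H : Ck k U (f * 'D_v g + g * 'D_v f).
  by apply: Ck_add => //; apply: IH => //;
    [exact: CkW Cf|exact: (Dg v)|exact: CkW Cg|exact: (Df v)].
apply: (Ck_congr oU _ H) => x Ux.
by rewrite deriveM //; apply: diff_derivable; [exact: df|exact: dg].
Qed.

Lemma Ck_sum k m (U : set 'rV[R]_m) (n : nat) (f : 'I_n -> 'rV[R]_m -> R) :
  open U -> (forall i, Ck k U (f i)) -> Ck k U (fun x => \sum_i f i x).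
Proof.
move=> oU H; have -> : (fun x => \sum_i f i x) = \sum_i f i.
  by apply/funext => x; rewrite fct_sumE.
elim/big_ind : _ => //; [exact: (@Ck_cst k m R U 0)|by move=> g h; exact: Ck_add].
Qed.

Lemma Ck_coord k m n (U : set 'rV[R]_m) (f : 'rV[R]_m -> 'rV[R]_n) :
  open U -> Ck k U f <-> forall j, Ck k U (fun x => f x 0 j).
Proof.
move=> oU.
have sE (g : 'rV[R]_m -> 'rV[R]_n) :
    g = \sum_j (fun x => g x 0 j *: delta_mx 0 j).
  by apply/funext => x; rewrite fct_sumE [LHS]row_sum_delta.
elim: k f => [|k IH] f.
  split=> [cf j x Ux|cf x Ux].
    apply: (@continuous_comp _ _ _ f (fun M : 'rV_n => M 0 j)); first exact: cf.
    exact: coord_continuous.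
  rewrite (sE f); elim/big_ind : _ => [|g h cg ch|j _].
  - exact: cst_continuous.
  - exact: continuousD.
  - by apply: continuousZl; exact: cf.
have Dj v j x (df : differentiable f x) : 'D_v f x 0 j = 'D_v (fun x => f x 0 j) x.
  by rewrite derive_mx ?mxE //; exact: diff_derivable.
split=> [[df Df] j|H].
  split=> [x Ux|v].
    apply: (@differentiable_comp _ _ _ _ f (fun M : 'rV_n => M 0 j)); first exact: df.
    exact: differentiable_coord.
  apply: (Ck_congr oU _ ((IH _).1 (Df v) j)) => x Ux /=.
  exact/Dj/df.
have df x : U x -> differentiable f x.
  move=> Ux; rewrite (sE f); apply: differentiable_sum => j.
  by apply: differentiableZl; exact: (H j).1.
split=> // v; apply/IH => j.
by apply: (Ck_congr oU _ ((H j).2 v)) => x Ux; exact/esym/Dj/df.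
Qed.

Lemma derive_comp m n (W : normedModType R) (f : 'rV[R]_m -> 'rV[R]_n)
    (g : 'rV[R]_n -> W) x v :
  differentiable f x -> differentiable g (f x) ->
  'D_v (g \o f) x = 'D_('D_v f x) g (f x).
Proof.
move=> df dg; rewrite !deriveE //; last exact: differentiable_comp.
by rewrite diff_comp.
Qed.

Lemma derive_coord m (W : normedModType R) (g : 'rV[R]_m -> W) x v :
  differentiable g x -> 'D_v g x = \sum_i v 0 i *: 'D_(delta_mx 0 i) g x.
Proof.
move=> dg; rewrite deriveE // {1}(row_sum_delta v) linear_sum.
by apply: eq_bigr => i _; rewrite linearZ deriveE.
Qed.

Lemma Ck_comp k m n (U : set 'rV[R]_m) (V : set 'rV[R]_n)
    (f : 'rV[R]_m -> 'rV[R]_n) (g : 'rV[R]_n -> R) :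
  open U -> open V -> (forall x, U x -> V (f x)) ->
  Ck k U f -> Ck k V g -> Ck k U (g \o f).
Proof.
move=> oU oV UV; elim: k f g UV => [|k IH] f g UV.
  by move=> cf cg x Ux; apply: continuous_comp; [exact: cf|exact/cg/UV].
move=> Cf Cg; have := (Cf, Cg) => -[[df Df] [dg Dg]]; split=> [x Ux|v].
  by apply: differentiable_comp; [exact: df|exact/dg/UV].
have H : Ck k U (fun x => \sum_i ((fun x => 'D_v f x 0 i) *
    ('D_(delta_mx 0 i) g \o f)) x).
  apply: Ck_sum => // i; apply: Ck_mul => //.
    by move: i; apply/Ck_coord => //; exact: Df.
  by apply: IH => //; [exact: CkW Cf|exact: Dg].
apply: (Ck_congr oU _ H) => x Ux.
rewrite derive_comp; [|exact: df|exact/dg/UV].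
by rewrite derive_coord//; exact/dg/UV.
Qed.

End Smooth.

(* cmap and cinv are only meaningful on the open sets cdom and cran, between    *)
(* which they are mutually inverse homeomorphisms.                             *)
Record chart (R : realType) (n : nat) (M : topologicalType) := Chart {
  cmap :> M -> 'rV[R]_n;
  cinv : 'rV[R]_n -> M;
  cdom : set M;
  cran : set 'rV[R]_n;
  cdom_open : open cdom;
  cran_open : open cran;
  cmap_ran : forall p, cdom p -> cran (cmap p);
  cinv_dom : forall x, cran x -> cdom (cinv x);
  cmapK : forall p, cdom p -> cinv (cmap p) = p;
  cinvK : forall x, cran x -> cmap (cinv x) = x;
  cmap_continuous : forall p, cdom p -> {for p, continuous cmap};
  cinv_continuous : forall x, cran x -> {for x, continuous cinv} }.

(* The image of U (inside cdom c) under the chart c. *)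
Definition chart_image (R : realType) (n : nat) (M : topologicalType)
    (c : chart R n M) (U : set M) : set 'rV[R]_n :=
  cran c `&` cinv c @^-1` U.

(* A Hausdorff, second countable manifold of dimension n without boundary. The *)
(* smooth atlas need not be maximal; chart_at selects a chart around each point.*)
Record manifold (R : realType) (n : nat) := Manifold {
  points :> topologicalType;
  atlas : Type;
  chart_of : atlas -> chart R n points;
  chart_at : points -> atlas;
  chart_atP : forall p, cdom (chart_of (chart_at p)) p;
  chart_transition : forall c d : atlas,
    smooth_on (chart_image (chart_of c) (cdom (chart_of d)))
              (chart_of d \o cinv (chart_of c));
  manifold_hausdorff : hausdorff_space points;
  manifold_second_countable : @second_countable points }.

Definition smooth (R : realType) (n : nat) (M : manifold R n)
    (W : normedModType R) (U : set M) (f : M -> W) : Prop :=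
  forall c : atlas M, smooth_on (chart_image (chart_of c) U)
                                (f \o cinv (chart_of c)).

Section SmoothManifold.
Context {R : realType} {n : nat} {M : manifold R n}.
Implicit Types (U V : set M) (c d e : atlas M) (p : M).
Local Notation K c := (chart_of c).

Lemma chart_image_open c U : open U -> open (chart_image (K c) U).
Proof.
move=> oU; rewrite openE => x [rx Ux].
have h1 : nbhs x (cran (K c)) by apply: open_nbhs_nbhs; split=> //; exact: cran_open.
have h2 : nbhs (cinv (K c) x) U by exact: open_nbhs_nbhs.
exact: filterI h1 (cinv_continuous rx h2).
Qed.

Lemma chart_imageP c U p : cdom (K c) p -> U p -> chart_image (K c) U (K c p).
Proof. by move=> dp Up; split; [exact: cmap_ran|rewrite /= cmapK]. Qed.

Lemma smooth_congr (W : normedModType R) U (f g : M -> W) :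
  open U -> (forall p, U p -> f p = g p) -> smooth U f -> smooth U g.
Proof.
move=> oU fg sf c k; apply: Ck_congr (sf c k); first exact: chart_image_open.
by move=> x [_ Ux]; exact: fg.
Qed.

Lemma smooth_local (W : normedModType R) U (f : M -> W) :
  (forall p, U p -> exists2 V, V p & smooth V f) -> smooth U f.
Proof.
move=> H c k; apply: Ck_local => x [rx Ux]; have [V Vx sV] := H _ Ux.
by exists (chart_image (K c) V); [split|exact: sV].
Qed.

Lemma smoothS (W : normedModType R) U V (f : M -> W) :
  U `<=` V -> smooth V f -> smooth U f.
Proof. by move=> UV sV; apply: smooth_local => p /UV Vp; exists V. Qed.

Lemma smooth_cst (W : normedModType R) U (w : W) : smooth U (fun=> w).
Proof. by move=> c k; exact: Ck_cst. Qed.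

Lemma smooth_add (W : normedModType R) U (f g : M -> W) :
  open U -> smooth U f -> smooth U g -> smooth U (f + g).
Proof.
by move=> oU sf sg c k; apply: Ck_add; [exact: chart_image_open|exact: sf|exact: sg].
Qed.

Lemma smooth_mul U (f g : M -> R) :
  open U -> smooth U f -> smooth U g -> smooth U (f * g).
Proof.
by move=> oU sf sg c k; apply: Ck_mul; [exact: chart_image_open|exact: sf|exact: sg].
Qed.

Lemma smooth_sum U (m : nat) (f : 'I_m -> M -> R) :
  open U -> (forall i, smooth U (f i)) -> smooth U (fun p => \sum_i f i p).
Proof.
by move=> oU sf c k; apply: Ck_sum => [|i]; [exact: chart_image_open|exact: sf].
Qed.

Lemma smooth_coord U (m : nat) (f : M -> 'rV[R]_m) : open U ->
  smooth U f <-> forall j, smooth U (fun p => f p 0 j).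
Proof.
move=> oU; split=> [sf j c k|sf c k].
  by move: j; apply/Ck_coord; [exact: chart_image_open|exact: sf].
by apply/Ck_coord; [exact: chart_image_open|move=> j; exact: sf].
Qed.

Lemma smooth_scale U (m : nat) (f : M -> R) (g : M -> 'rV[R]_m) :
  open U -> smooth U f -> smooth U g -> smooth U (fun p => f p *: g p).
Proof.
move=> oU sf /(smooth_coord _ oU) sg; apply/(smooth_coord _ oU) => j.
have -> : (fun p => (f p *: g p) 0 j) = f * (fun p => g p 0 j).
  by apply/funext => p; rewrite mxE.
exact: smooth_mul.
Qed.

Lemma chart_transition_smooth c d : smooth (cdom (K c)) (K c).
Proof. by move=> e; exact: chart_transition. Qed.

Lemma smooth_comp_chart c (U : set 'rV[R]_n) (g : 'rV[R]_n -> R) :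
  open U -> smooth_on U g ->
  smooth (cdom (K c) `&` K c @^-1` U) (g \o K c).
Proof.
move=> oU sg e k.
have oV : open (cdom (K c) `&` K c @^-1` U).
  rewrite openE => p [dp Up]; apply: filterI.
    by apply: open_nbhs_nbhs; split=> //; exact: cdom_open.
  by apply: (cmap_continuous dp); exact: open_nbhs_nbhs.
apply: (@Ck_comp _ k _ _ _ U (K c \o cinv (K e)) g) => //.
- exact: chart_image_open.
- by move=> x [rx [dx Ux]].
- apply: CkS (chart_transition e c k) => x [rx [dx Ux]]; by split.
Qed.

End SmoothManifold.

(* A vector bundle of rank r is given by its fibers and by local               *)
(* trivializations tmap i : E|_(tdom i) -> tdom i x R^r, linear isomorphisms on*)
(* the fibers with smooth transition functions; this determines the topology   *)
(* and the smooth structure of the total space. Values of tmap i p and tinv i p*)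
(* for p outside tdom i are irrelevant.                                        *)
Record vector_bundle (R : realType) (n : nat) (M : manifold R n) (r : nat) :=
  VectorBundle {
  fiber :> M -> lmodType R;
  triv : Type;
  tdom : triv -> set M;
  tmap : forall (i : triv) (p : M), fiber p -> 'rV[R]_r;
  tinv : forall (i : triv) (p : M), 'rV[R]_r -> fiber p;
  tdom_open : forall i, open (tdom i);
  tdom_cover : forall p, exists i, tdom i p;
  tmap_linear : forall i p, tdom i p -> linear (@tmap i p);
  tmapK : forall i p, tdom i p -> cancel (@tmap i p) (@tinv i p);
  tinvK : forall i p, tdom i p -> cancel (@tinv i p) (@tmap i p);
  triv_transition : forall i j (v : 'rV[R]_r),
    smooth (tdom i `&` tdom j) (fun p => @tmap j p (@tinv i p v)) }.

Arguments tmap {R n M r} v i p _ : rename.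
Arguments tinv {R n M r} v i p _ : rename.
Arguments tdom {R n M r} v i _ : rename.

Definition smooth_section (R : realType) (n : nat) (M : manifold R n) (r : nat)
    (E : vector_bundle M r) (U : set M) (X : forall p, E p) : Prop :=
  forall i, smooth (U `&` tdom E i) (fun p => tmap E i p (X p)).

Record Cinf (R : realType) (n : nat) (M : manifold R n) := MkCinf {
  Cinf_fun :> M -> R;
  Cinf_smooth : smooth setT Cinf_fun }.

Record Sec (R : realType) (n : nat) (M : manifold R n) (r : nat)
    (E : vector_bundle M r) := MkSec {
  Sec_fun :> forall p, E p;
  Sec_smooth : smooth_section setT Sec_fun }.

HB.instance Definition _ (R : realType) (n : nat) (M : manifold R n) :=
  gen_eqMixin (Cinf M).
HB.instance Definition _ (R : realType) (n : nat) (M : manifold R n) :=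
  gen_choiceMixin (Cinf M).
HB.instance Definition _ (R : realType) (n : nat) (M : manifold R n) (r : nat)
  (E : vector_bundle M r) := gen_eqMixin (Sec E).
HB.instance Definition _ (R : realType) (n : nat) (M : manifold R n) (r : nat)
  (E : vector_bundle M r) := gen_choiceMixin (Sec E).

Section CinfRing.
Context {R : realType} {n : nat} {M : manifold R n}.
Implicit Types f g h : Cinf M.

Lemma Cinf_eq f g : (forall p, f p = g p) -> f = g.
Proof.
case: f g => [f sf] [g sg] /= /funext fg; move: sf sg; rewrite fg => sf sg.
by congr MkCinf; exact: Prop_irrelevance.
Qed.

Definition Cinf_cst (a : R) : Cinf M := MkCinf (smooth_cst setT a).

Definition Cinf_add f g : Cinf M :=
  MkCinf (smooth_add openT (Cinf_smooth f) (Cinf_smooth g)).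

Definition Cinf_mul f g : Cinf M :=
  MkCinf (smooth_mul openT (Cinf_smooth f) (Cinf_smooth g)).

Definition Cinf_opp f : Cinf M := Cinf_mul (Cinf_cst (-1)) f.

Fact Cinf_addA : associative Cinf_add.
Proof. by move=> f g h; apply: Cinf_eq => p; exact: addrA. Qed.
Fact Cinf_addC : commutative Cinf_add.
Proof. by move=> f g; apply: Cinf_eq => p; exact: addrC. Qed.
Fact Cinf_add0 : left_id (Cinf_cst 0) Cinf_add.
Proof. by move=> f; apply: Cinf_eq => p; exact: add0r. Qed.
Fact Cinf_addN : left_inverse (Cinf_cst 0) Cinf_opp Cinf_add.
Proof.
move=> f; apply: Cinf_eq => p.
by rewrite /= !fctE -[X in _ + X]mul1r -mulrDl addNr mul0r.
Qed.
HB.instance Definition _ := GRing.isZmodule.Build (Cinf M)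
  Cinf_addA Cinf_addC Cinf_add0 Cinf_addN.

Fact Cinf_mulA : associative Cinf_mul.
Proof. by move=> f g h; apply: Cinf_eq => p; exact: mulrA. Qed.
Fact Cinf_mulC : commutative Cinf_mul.
Proof. by move=> f g; apply: Cinf_eq => p; exact: mulrC. Qed.
Fact Cinf_mul1 : left_id (Cinf_cst 1) Cinf_mul.
Proof. by move=> f; apply: Cinf_eq => p; exact: mul1r. Qed.
Fact Cinf_mulDl : left_distributive Cinf_mul Cinf_add.
Proof. by move=> f g h; apply: Cinf_eq => p; exact: mulrDl. Qed.
HB.instance Definition _ := GRing.Zmodule_isComPzRing.Build (Cinf M)
  Cinf_mulA Cinf_mulC Cinf_mul1 Cinf_mulDl.

End CinfRing.

Section SecModule.
Context {R : realType} {n : nat} {M : manifold R n} {r : nat}.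
Context {E : vector_bundle M r}.
Implicit Types (X Y Z : Sec E) (f g : Cinf M).

Lemma Sec_eq X Y : (forall p, X p = Y p) -> X = Y.
Proof.
case: X Y => [X sX] [Y sY] /= XY.
have {XY} XY : X = Y by exact: functional_extensionality_dep.
by move: sX sY; rewrite XY => sX sY; congr MkSec; exact: Prop_irrelevance.
Qed.

Let oT i : open ([set: M] `&` tdom E i).
Proof. by rewrite setTI; exact: tdom_open. Qed.

Let tmapD i p u v : tdom E i p -> tmap E i p (u + v) = tmap E i p u + tmap E i p v.
Proof. by move=> /(@tmap_linear _ _ _ _ E) tl; rewrite -[u in LHS]scale1r tl scale1r. Qed.

Let tmap0 i p : tdom E i p -> tmap E i p 0 = 0.
Proof.
by move=> tp; apply: (addrI (tmap E i p 0)); rewrite -tmapD ?addr0.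
Qed.

Let tmapZ i p a v : tdom E i p -> tmap E i p (a *: v) = a *: tmap E i p v.
Proof.
by move=> tp; have tl := tmap_linear tp; rewrite -[_ *: v]addr0 tl tmap0 ?addr0.
Qed.

Fact Sec_zero_smooth : smooth_section setT (fun p => 0 : E p).
Proof.
move=> i; apply: (smooth_congr (oT i) _ (smooth_cst _ 0)) => p [_ ip].
by rewrite tmap0.
Qed.
Definition Sec_zero : Sec E := MkSec Sec_zero_smooth.

Fact Sec_add_smooth X Y : smooth_section setT (fun p => X p + Y p).
Proof.
move=> i; apply: (smooth_congr (oT i) _
  (smooth_add (oT i) (Sec_smooth X i) (Sec_smooth Y i))) => p [_ ip].
by rewrite tmapD.
Qed.
Definition Sec_add X Y : Sec E := MkSec (Sec_add_smooth X Y).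

Fact Sec_scale_smooth f X : smooth_section setT (fun p => f p *: X p).
Proof.
move=> i; have sf : smooth ([set: M] `&` tdom E i) f.
  by apply: smoothS (Cinf_smooth f).
apply: (smooth_congr (oT i) _ (smooth_scale (oT i) sf (Sec_smooth X i))) => p [_ ip].
by rewrite tmapZ.
Qed.
Definition Sec_scale f X : Sec E := MkSec (Sec_scale_smooth f X).

Fact Sec_addA : associative Sec_add.
Proof. by move=> X Y Z; apply: Sec_eq => p; exact: addrA. Qed.
Fact Sec_addC : commutative Sec_add.
Proof. by move=> X Y; apply: Sec_eq => p; exact: addrC. Qed.
Fact Sec_add0 : left_id Sec_zero Sec_add.
Proof. by move=> X; apply: Sec_eq => p; exact: add0r. Qed.
Fact Sec_addN : left_inverse Sec_zero (Sec_scale (Cinf_cst (-1))) Sec_add.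
Proof. by move=> X; apply: Sec_eq => p; rewrite /= scaleN1r addNr. Qed.
HB.instance Definition _ := GRing.isZmodule.Build (Sec E)
  Sec_addA Sec_addC Sec_add0 Sec_addN.

Fact Sec_scaleA f g X : Sec_scale f (Sec_scale g X) = Sec_scale (f * g) X.
Proof. by apply: Sec_eq => p; exact: scalerA. Qed.
Fact Sec_scale1 : left_id 1 Sec_scale.
Proof. by move=> X; apply: Sec_eq => p; exact: scale1r. Qed.
Fact Sec_scaleDr : right_distributive Sec_scale +%R.
Proof. by move=> f X Y; apply: Sec_eq => p; exact: scalerDr. Qed.
Fact Sec_scaleDl X : {morph Sec_scale^~ X : f g / f + g}.
Proof. by move=> f g; apply: Sec_eq => p; exact: scalerDl. Qed.
HB.instance Definition _ := GRing.Zmodule_isLmodule.Build (Cinf M) (Sec E)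
  Sec_scaleA Sec_scale1 Sec_scaleDr Sec_scaleDl.

End SecModule.

Section Tangent.
Context {R : realType} {n : nat} {M : manifold R n}.
Implicit Types (U V : set M) (c d e : atlas M) (p : M).
Local Notation K c := (chart_of c).

Definition jac c d p (v : 'rV[R]_n) : 'rV[R]_n :=
  'D_v (K d \o cinv (K c)) (K c p).

Lemma jac_differentiable c d p : cdom (K c) p -> cdom (K d) p ->
  differentiable (K d \o cinv (K c)) (K c p).
Proof. by move=> cp dp; exact: (chart_transition c d 1).1 (chart_imageP cp dp). Qed.

Lemma jac_linear c d p : cdom (K c) p -> cdom (K d) p -> linear (jac c d p).
Proof.
move=> cp dp a u v; have df := jac_differentiable cp dp.
by rewrite /jac !deriveE // linearP.
Qed.

Lemma jac_comp c d e p v : cdom (K c) p -> cdom (K d) p -> cdom (K e) p ->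
  jac d e p (jac c d p v) = jac c e p v.
Proof.
move=> cp dp ep; rewrite /jac.
have Kd : K d p = (K d \o cinv (K c)) (K c p) by rewrite /= cmapK.
rewrite Kd -derive_comp; last 2 first.
- exact: jac_differentiable.
- by rewrite -Kd; exact: jac_differentiable.
apply: near_eq_derive.
apply: (@near_open _ (chart_image (K c) (cdom (K d)))).
- by apply: chart_image_open; exact: cdom_open.
- exact: chart_imageP.
- by move=> x [rx dx] /=; rewrite cmapK.
Qed.

Lemma jac_id c p v : cdom (K c) p -> jac c c p v = v.
Proof.
move=> cp; rewrite /jac -[RHS](derive_id (K c p)).
apply: near_eq_derive; apply: (@near_open _ (cran (K c))).
- exact: cran_open.
- exact: cmap_ran.
- by move=> x rx; exact: cinvK.
Qed.

(* T_pM is R^n, seen through the selected chart at p: a tangent vector v at p   *)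
(* has coordinates jac (chart_at p) c p v in another chart c around p.         *)
Definition ttmap c p : 'rV[R]_n -> 'rV[R]_n := jac (chart_at p) c p.
Definition ttinv c p : 'rV[R]_n -> 'rV[R]_n := jac c (chart_at p) p.

Fact ttmap_linear c p : cdom (K c) p -> linear (ttmap c p).
Proof. by move=> cp; apply: jac_linear => //; exact: chart_atP. Qed.

Fact ttmapK c p : cdom (K c) p -> cancel (ttmap c p) (ttinv c p).
Proof.
move=> cp v; have kp := chart_atP p.
by rewrite /ttmap /ttinv jac_comp // jac_id.
Qed.

Fact ttinvK c p : cdom (K c) p -> cancel (ttinv c p) (ttmap c p).
Proof.
move=> cp v; have kp := chart_atP p.
by rewrite /ttmap /ttinv jac_comp // jac_id.
Qed.

Fact tt_cover p : exists c, cdom (K c) p.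
Proof. by exists (chart_at p); exact: chart_atP. Qed.

Fact tt_transition c d (v : 'rV[R]_n) :
  smooth (cdom (K c) `&` cdom (K d)) (fun p => ttmap d p (ttinv c p v)).
Proof.
set W := _ `&` _.
have oW : open W by apply: openI; exact: cdom_open.
have oI : open (chart_image (K c) (cdom (K d))).
  by apply: chart_image_open; exact: cdom_open.
apply/(smooth_coord _ oW) => j.
pose g x := ('D_v (K d \o cinv (K c)) x) 0 j.
have sg : smooth_on (chart_image (K c) (cdom (K d))) g.
  by move=> k; move: j @g; apply/(Ck_coord _ _ oI); exact: (chart_transition c d k.+1).2.
have /smoothS sG := smooth_comp_chart c oI sg.
apply: (smooth_congr oW _ (sG W _)) => [p [cp dp]|p [cp dp]].
  have kp := chart_atP p.
  by rewrite /g /= /ttmap /ttinv jac_comp.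
by split=> //; exact: chart_imageP.
Qed.

Definition TM : vector_bundle M n :=
  @VectorBundle R n M n (fun=> 'rV[R]_n) (atlas M) (fun c => cdom (K c))
    ttmap ttinv (fun c => cdom_open (K c)) tt_cover
    ttmap_linear ttmapK ttinvK tt_transition.

(* d_p f (v), the derivative of f at p along the tangent vector v. *)
Definition dfun (f : M -> R) p (v : TM p) : R :=
  'D_(v : 'rV[R]_n) (f \o cinv (K (chart_at p))) (K (chart_at p) p).

Lemma dfun_chart U (f : M -> R) c p (v : TM p) :
  open U -> smooth U f -> U p -> cdom (K c) p ->
  dfun f v = 'D_(tmap TM c p v) (f \o cinv (K c)) (K c p).
Proof.
move=> oU sf Up cp; have kp := chart_atP p.
rewrite /dfun /= /ttmap /jac.
have Kc : K c p = (K c \o cinv (K (chart_at p))) (K (chart_at p) p).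
  by rewrite /= cmapK.
rewrite Kc -derive_comp; last 2 first.
- exact: jac_differentiable.
- by rewrite -Kc; exact: (sf c 1%N).1 (chart_imageP cp Up).
apply: near_eq_derive.
apply: (@near_open _ (chart_image (K (chart_at p)) (cdom (K c)))).
- by apply: chart_image_open; exact: cdom_open.
- exact: chart_imageP.
- by move=> x [rx dx] /=; rewrite cmapK.
Qed.

Fact vf_app_smooth (X : Sec TM) (f : Cinf M) :
  smooth setT (fun p => dfun f (X p)).
Proof.
have sf := Cinf_smooth f.
apply: smooth_local => p0 _; set c := chart_at p0.
exists (cdom (K c)); first exact: chart_atP.
have oc := cdom_open (K c).
pose g i p := tmap TM c p (X p) 0 i *
  'D_(delta_mx 0 i) (f \o cinv (K c)) (K c p).
have sg : smooth (cdom (K c)) (fun p => \sum_i g i p).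
  apply: smooth_sum => // i; apply: smooth_mul => //.
    move: i {g}; apply/(smooth_coord _ oc).
    by apply: smoothS (Sec_smooth X c); rewrite setTI.
  have oI : open (chart_image (K c) setT).
    by apply: chart_image_open; exact: openT.
  have sD : smooth_on (chart_image (K c) setT) ('D_(delta_mx 0 i) (f \o cinv (K c))).
    by move=> k; exact: (sf c k.+1).2.
  apply: smoothS (smooth_comp_chart c oI sD) => p cp.
  by split=> //; exact: chart_imageP.
apply: (smooth_congr oc _ sg) => p cp; rewrite (dfun_chart _ openT sf _ cp) //.
by rewrite derive_coord //; exact: (sf c 1%N).1 (chart_imageP cp _).
Qed.

Definition vf_app (X : Sec TM) (f : Cinf M) : Cinf M :=
  MkCinf (vf_app_smooth X f).

(* Z = [X, Y]_vf, the vector field acting on functions as the commutator. *)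
Definition is_vf_bracket (X Y Z : Sec TM) : Prop :=
  forall f : Cinf M, vf_app Z f = vf_app X (vf_app Y f) - vf_app Y (vf_app X f).

End Tangent.

Arguments TM {R n} M.

(* A vector bundle morphism over the identity of M: smoothness of the map of   *)
(* total spaces is read in local trivializations.                              *)
Record bundle_morphism (R : realType) (n : nat) (M : manifold R n) (r s : nat)
    (E : vector_bundle M r) (F : vector_bundle M s) := BundleMorphism {
  bm_fun :> forall p : M, {linear E p -> F p};
  bm_smooth : forall i j (v : 'rV[R]_r),
    smooth (tdom E i `&` tdom F j)
           (fun p => tmap F j p (bm_fun p (tinv E i p v))) }.

Section BundleMorphism.
Context {R : realType} {n : nat} {M : manifold R n} {r s : nat}.
Context {E : vector_bundle M r} {F : vector_bundle M s}.

Fact bm_app_smooth (a : bundle_morphism E F) (X : Sec E) :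
  smooth_section setT (fun p => a p (X p)).
Proof.
move=> j; apply: smooth_local => p0 [_ jp0].
have [i ip0] := tdom_cover E p0.
pose W := tdom E i `&` tdom F j; exists W => //.
have oW : open W by apply: openI; exact: tdom_open.
apply/(smooth_coord _ oW) => l.
pose g k p := tmap E i p (X p) 0 k *
  tmap F j p (a p (tinv E i p (delta_mx 0 k))) 0 l.
have sg : smooth W (fun p => \sum_k g k p).
  apply: smooth_sum => // k; apply: smooth_mul => //.
    move: k {g}; apply/(smooth_coord _ oW).
    by apply: smoothS (Sec_smooth X i) => p [].
  by move: l {g}; apply/(smooth_coord _ oW); exact: bm_smooth.
apply: (smooth_congr oW _ sg) => p [ip jp].
have lE : linear (tinv E i p).
  move=> b u v; apply: (can_inj (tmapK ip)).
  by rewrite (tmap_linear ip) !(tinvK ip).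
pose L : {linear 'rV[R]_r -> E p} := HB.pack (tinv E i p)
  (GRing.isLinear.Build _ _ _ _ (tinv E i p) lE).
pose L' : {linear F p -> 'rV[R]_s} := HB.pack (tmap F j p)
  (GRing.isLinear.Build _ _ _ _ (tmap F j p) (tmap_linear jp)).
have -> : tmap F j p (a p (X p)) = L' (a p (L (tmap E i p (X p)))).
  by rewrite /L /L' /= tmapK.
rewrite (row_sum_delta (tmap E i p (X p))) !linear_sum summxE.
by apply: eq_bigr => k _; rewrite !linearZ mxE.
Qed.

Definition bm_app (a : bundle_morphism E F) (X : Sec E) : Sec F :=
  MkSec (bm_app_smooth a X).

End BundleMorphism.

Section Brackets.
Context {R : realType} {n : nat} {M : manifold R n} {r : nat}.
Context {E : vector_bundle M r}.
Implicit Types (D : Sec E -> Sec E) (br : Sec E -> Sec E -> Sec E).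

(* The scalars of R act on Sec E through the constant functions of Cinf M. *)
Definition R_linear D : Prop :=
  (forall X Y, D (X + Y) = D X + D Y) /\
  (forall (a : R) X, D (Cinf_cst a *: X) = Cinf_cst a *: D X).

Definition quasi_derivation D : Prop :=
  R_linear D /\
  forall f : Cinf M, exists Df : Cinf M,
    forall X, D (f *: X) = f *: D X + Df *: X.

Definition R_bilinear br : Prop :=
  (forall X, R_linear (br X)) /\ (forall Y, R_linear (br^~ Y)).

Definition jacobi_identity br : Prop :=
  forall X Y Z, br (br X Y) Z = br X (br Y Z) - br Y (br X Z).

Definition skew_symmetric br : Prop := forall X Y, br X Y = - br Y X.

Definition supp (X : Sec E) : set M := closure [set p | X p <> 0].

Definition local_lie_algebra br : Prop :=
  [/\ R_bilinear br, skew_symmetric br, jacobi_identity br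
    & forall X Y, supp (br X Y) `<=` supp X `&` supp Y].

End Brackets.

Section JacobiBracket.
Context {R : realType} {n : nat} {M : manifold R n}.
Implicit Types (U : set M) (f g h : M -> R).

(* A bivector at p is a skew-symmetric element of T_pM (x) T_pM; since the     *)
(* fiber of TM at p is 'rV_n, it is stored as its n x n coefficient matrix.    *)
Definition bivector_app (L : M -> 'M[R]_n) f g : M -> R := fun p =>
  \sum_(i < n) \sum_(j < n)
    L p i j * dfun f (delta_mx 0 i : TM M p) * dfun g (delta_mx 0 j : TM M p).

Definition chart_coord (c : atlas M) (i : 'I_n) : M -> R :=
  fun p => chart_of c p 0 i.

Definition bivector_field U (L : M -> 'M[R]_n) : Prop :=
  (forall p, U p -> (L p)^T = - L p) /\
  (forall (c : atlas M) (i j : 'I_n), smooth (U `&` cdom (chart_of c))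
     (bivector_app L (chart_coord c i) (chart_coord c j))).

(* An element of C^oo(U) is represented by a function on M that is smooth on   *)
(* U and whose values outside of the open set U are irrelevant.                *)
Definition jacobi_bracket U (b : (M -> R) -> (M -> R) -> M -> R) : Prop :=
  (exists (L : M -> 'M[R]_n) (G : forall p, TM M p),
     [/\ bivector_field U L, smooth_section U G &
         forall f g, smooth U f -> smooth U g -> forall p, U p ->
           b f g p = bivector_app L f g p
                     + f p * dfun g (G p) - g p * dfun f (G p)]) /\
  (forall f g h, smooth U f -> smooth U g -> smooth U h -> forall p, U p ->
     b (b f g) h p = b f (b g h) p - b g (b f h) p).

End JacobiBracket.

Section LocallyJacobi.
Context {R : realType} {n : nat} {M : manifold R n} {r : nat}.
Variable E : vector_bundle M r.

(* The fiberwise bijections onto R force E to have rank 1 over U. *)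
Definition line_trivialization (U : set M) (t : forall p, E p -> R) : Prop :=
  [/\ open U,
      forall p, U p -> scalar (t p),
      forall p, U p -> bijective (t p)
    & forall i (v : 'rV[R]_r),
        smooth (U `&` tdom E i) (fun p => t p (tinv E i p v))].

(* b is the bracket induced on C^oo(U): a germ of a function on U extends to a *)
(* global section, so b f g is prescribed near every point of U by br.         *)
Definition locally_jacobi (br : Sec E -> Sec E -> Sec E) : Prop :=
  forall (U : set M) (t : forall p, E p -> R), line_trivialization U t ->
  exists b : (M -> R) -> (M -> R) -> M -> R,
    jacobi_bracket U b /\
    forall (V : set M) (f g : M -> R) (X Y : Sec E),
      open V -> V `<=` U -> smooth U f -> smooth U g ->
      (forall p, V p -> f p = t p (X p)) ->
      (forall p, V p -> g p = t p (Y p)) ->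
      forall p, V p -> b f g p = t p (br X Y p).

End LocallyJacobi.

(* Main.v *)
(* Write [X, fY] = f[X, Y] + l_X(f) Y and [fX, Y] = f[X, Y] + r_Y(f) X; the
   symbols l_X and r_Y are derivations of C^oo(M). By the Jacobi identity
   S(X, Y) = [X, Y] + [Y, X] satisfies [S(X, Y), Z] = 0; replacing Y by fY, then
   by g(fY), gives with c_X = l_X + r_X
     c_X(f)[Y, Z] + r_Z(f) S(X, Y) + r_Z(c_X(f)) Y = 0,
     c_X(f) r_Z(g) + r_Z(f) c_X(g) = 0.
   If c_X(f) did not vanish at p, the second line would make every r_Z, then the
   first one every bracket and hence every l_X, vanish at p: a contradiction. So
   r = - l, and the first line shows S = 0 wherever l does not vanish.
   Expanding [fX, gY] in two ways,
     (l_{fX}(g) - f l_X(g)) Y = (g l_Y(f) - l_{gY}(f)) X,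
   so in rank > 1 the symbol l is C^oo(M)-linear and comes from a bundle map.
   In rank 1, for a local frame e, the same identity makes
   Lambda(f, g) = l_{fe}(g) - f l_e(g) a skew biderivation, and
   [fe, ge] = (Lambda(f, g) + f l_e(g) - g l_e(f)) e.
   That derivations are tangent vectors is Hadamard's lemma; passing between
   local and global objects uses bump functions. *)
From HB Require Import structures.
Require Import Defs.
From mathcomp Require Import all_boot all_order all_algebra.
From mathcomp Require Import all_classical all_reals all_analysis.
From mathcomp Require Import ring.

Import Order.TTheory GRing.Theory Num.Theory numFieldNormedType.Exports.
Local Open Scope classical_set_scope.
Local Open Scope ring_scope.

Set Implicit Arguments.
Unset Strict Implicit.
Unset Printing Implicit Defensive.

(** * Hadamard's lemma *)

(** The differential is prescribed in advance: an epsilon bound on the remainder identifies it by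
    uniqueness of the differential. *)
Lemma differentiable_linear {R : numFieldType} {V W : normedModType R}
    (F : V -> W) (L : {linear V -> W}) (x : V) :
  continuous L ->
  (forall e : R, 0 < e ->
     \forall w \near (0 : V), `|F (w + x) - F x - L w| <= e * `|w|) ->
  differentiable F x /\ forall v, 'D_v F x = L v.
Proof.
move=> cL H.
have FE : F \o shift x = cst (F x) + L +o_ 0 id.
  apply/eqaddoP => e e0; move: (H e e0); apply: filterS => w /=.
  by rewrite !fctE /= opprD addrA.
have dE := diff_unique cL FE.
have dF : differentiable F x by apply/diff_locallyP; rewrite dE; split.
by split=> // v; rewrite deriveE // dE.
Qed.

Lemma differentiable_rV {R : realType} {W : normedModType R} {m : nat}
    (F : 'rV[R]_m -> W) (x : 'rV[R]_m) (a : 'I_m -> W) :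
  (forall e : R, 0 < e -> \forall w \near (0 : 'rV[R]_m),
     `|F (w + x) - F x - \sum_i w 0 i *: a i| <= e * `|w|) ->
  differentiable F x /\ forall v, 'D_v F x = \sum_i v 0 i *: a i.
Proof.
move=> H.
pose L := fun v : 'rV[R]_m => \sum_i v 0 i *: a i.
have lL : linear L.
  move=> k u v; rewrite /L scaler_sumr -big_split; apply: eq_bigr => i _ /=.
  by rewrite !mxE scalerDl scalerA.
pose L' : {linear 'rV[R]_m -> W} := HB.pack L (GRing.isLinear.Build _ _ _ _ L lL).
have cL : continuous L.
  have -> : L = \sum_i (fun v => v 0 i *: a i).
    by apply/funext => v; rewrite fct_sumE.
  elim/big_ind : _ => [|g h cg ch|i _] v; first exact: cst_continuous.
    by apply: continuousD; [exact: cg|exact: ch].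
  by apply: continuousZr_tmp; exact: coord_continuous.
exact: (differentiable_linear (L := L')).
Qed.

Lemma near_translate {R : numFieldType} {V : normedModType R} (x : V) (P : V -> Prop) :
  (\forall w \near (0 : V), P (w + x)) <-> \forall y \near x, P y.
Proof.
rewrite (near_shift 0 x P) subr0.
by split; apply: filterS.
Qed.

Lemma is_derive_line {R : realType} {V W : normedModType R} (h : V -> W) (p u : V) (s : R) :
  derivable h (p + s *: u) u ->
  is_derive s 1 (fun s : R => h (p + s *: u)) ('D_u h (p + s *: u)).
Proof.
have E : (fun k : R => k^-1 *: (((fun s : R => h (p + s *: u)) \o shift s) (k *: 1)
             - h (p + s *: u)))
       = (fun k : R => k^-1 *: ((h \o shift (p + s *: u)) (k *: u) - h (p + s *: u))).
  apply/funext => k /=; congr (_ *: (h _ - _)).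
  have -> : k%:A = k :> R by exact: mulr1.
  by rewrite scalerDl addrCA.
by move=> dh; apply: DeriveDef; rewrite /derivable /derive /= E.
Qed.

(** * Integration over the unit interval *)

Section UnitIntegral.
Context {R : realType}.
Implicit Types (f g : R -> R) (e : R).
Local Notation mu := (@lebesgue_measure R).
Let I01 : set R := `[0, 1]%classic.

Definition unit_integral f : R := \int[mu]_(t in I01) f t.

Let mI01 : measurable I01.
Proof. exact: measurable_itv. Qed.

Let cont_integrable f : continuous f -> mu.-integrable I01 (EFin \o f).
Proof.
move=> cf; apply: continuous_compact_integrable; first exact: segment_compact.
exact: continuous_subspaceT.
Qed.

Lemma unit_integralD f g : continuous f -> continuous g ->
  unit_integral (fun t => f t + g t) = unit_integral f + unit_integral g.
Proof. by move=> cf cg; apply: RintegralD => //; exact: cont_integrable. Qed.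

Lemma unit_integralZ (a : R) f : continuous f ->
  unit_integral (fun t => a * f t) = a * unit_integral f.
Proof. by move=> cf; apply: RintegralZl => //; exact: cont_integrable. Qed.

Lemma unit_integral_sum (I : finType) (b : I -> R) (f : I -> R -> R) :
  (forall i, continuous (f i)) ->
  unit_integral (fun t => \sum_i b i * f i t) = \sum_i b i * unit_integral (f i).
Proof.
move=> cf; rewrite -[RHS]big_enum /=.
have -> : (fun t => \sum_i b i * f i t) = (fun t => \sum_(i <- enum I) b i * f i t).
  by apply/funext => t; rewrite big_enum.
(* Continuity travels with the equation through the induction, because additivity of the integral
   asks for it. *)
suff [] : continuous (fun t => \sum_(i <- enum I) b i * f i t) /\
  unit_integral (fun t => \sum_(i <- enum I) b i * f i t) =
  \sum_(i <- enum I) b i * unit_integral (f i) by [].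
elim: (enum I) => [|i s [cs IH]].
  under eq_fun do rewrite big_nil; rewrite big_nil.
  split; first exact: cst_continuous.
  rewrite -[RHS](mul0r (unit_integral (cst 0))) -unit_integralZ; last exact: cst_continuous.
  by congr unit_integral; apply/funext => t; rewrite mul0r.
under eq_fun do rewrite big_cons; rewrite big_cons.
have ci : continuous (fun t => b i * f i t).
  by move=> t; apply: (@continuousM _ _ (cst (b i)) (f i)); [exact: cst_continuous|exact: cf].
split; last by rewrite unit_integralD // unit_integralZ // IH.
by move=> t; exact: (continuousD (ci t) (cs t)).
Qed.

Lemma unit_integralB f g : continuous f -> continuous g ->
  unit_integral (fun t => f t - g t) = unit_integral f - unit_integral g.
Proof. by move=> cf cg; apply: RintegralB => //; exact: cont_integrable. Qed.

Lemma unit_integral_le f e : continuous f ->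
  (forall t, 0 <= t <= 1 -> `|f t| <= e) -> `|unit_integral f| <= e.
Proof.
move=> cf fe; have le1 := @le_normr_Rintegral _ _ _ mu I01 f mI01 (cont_integrable cf).
apply: (le_trans le1).
have -> : e = \int[mu]_(t in I01) (cst e t).
  rewrite (@Rintegral_cst _ _ _ mu I01 mI01 e).
  have muI : mu I01 = 1%E.
    by rewrite /I01 lebesgue_measure_itv /= lte_fin ltr01 oppr0 adde0.
  by transitivity (e * 1); [rewrite mulr1|exact: (congr1 (fun z => e * fine z) (esym muI))].
apply: (@le_Rintegral _ _ _ mu I01 (fun t => `|f t|) (cst e) mI01) => //.
- by apply: cont_integrable => t; apply: continuous_comp; [exact: cf|exact: norm_continuous].
- by apply: cont_integrable; exact: cst_continuous.
Qed.

Lemma unit_integral_derive (F f : R -> R) : continuous f ->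
  (forall t : R, is_derive t 1 F (f t)) -> unit_integral f = F 1 - F 0.
Proof.
move=> cf Ff; have cF t : {for t, continuous F}.
  by apply/differentiable_continuous/derivable1_diffP; exact: ex_derive.
rewrite /unit_integral /Rintegral (@continuous_FTC2 _ f F) ?ltr01 //.
- exact: continuous_subspaceT.
- split; [by move=> t _; exact: ex_derive| |].
    by apply: cvg_at_right_filter; exact: cF.
  by apply: cvg_at_left_filter; exact: cF.
- by move=> t _; rewrite derive1E derive_val.
Qed.

End UnitIntegral.

(** * Weighted integrals along rays from a centre *)

Section RadialIntegral.
Context {R : realType} {m : nat} (c : 'rV[R]_m).
Implicit Types (h : 'rV[R]_m -> R) (x v w : 'rV[R]_m) (t : R).

Definition ray x t : 'rV[R]_m := c + t *: (x - c).

(* The weight [t ^+ j] is there because differentiating in [x] raises [j] by one,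
   which makes the family stable under differentiation. *)
Definition radial_integral (j : nat) h x : R :=
  unit_integral (fun t => t ^+ j * h (ray x t)).

Let rayD w x t : ray (w + x) t = ray x t + t *: w.
Proof. by rewrite /ray -addrA scalerDr addrCA addrC. Qed.

Let ray_continuous2 x (z0 : R * 'rV[R]_m) :
  {for z0, continuous (fun z : R * 'rV[R]_m => ray (z.2 + x) z.1)}.
Proof.
apply: (@continuousD _ _ _ (fun=> c) (fun z : R * 'rV[R]_m => z.1 *: (z.2 + x - c))).
  exact: cst_continuous.
apply: (@continuousZ _ _ _ (fun z : R * 'rV[R]_m => z.1) (fun z => z.2 + x - c)).
  exact: cvg_fst.
apply: continuousB; last exact: cst_continuous.
by apply: (@continuousD _ _ _ snd (fun=> x)); [exact: cvg_snd|exact: cst_continuous].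
Qed.

Let ray_continuous x : continuous (ray x).
Proof.
move=> t; apply: (@continuousD _ _ _ (fun=> c) (fun t => t *: (x - c))).
  exact: cst_continuous.
by apply: continuousZr_tmp; exact: cvg_id.
Qed.

Let weight_continuous j h x : continuous h ->
  continuous (fun t => t ^+ j * h (ray x t)).
Proof.
move=> ch t; apply: (@continuousM _ _ (fun t => t ^+ j) (h \o ray x)).
  exact: exprn_continuous.
by apply: continuous_comp; [exact: ray_continuous|exact: ch].
Qed.

Let continuous_sub (f g : R -> R) : continuous f -> continuous g ->
  continuous (fun t => f t - g t).
Proof. by move=> cf cg t; exact: (continuousB (cf t) (cg t)). Qed.

(** The difference is jointly continuous in [t] and [w] and vanishes at [w = 0]; compactness of
    [0, 1] makes the bound uniform in [t]. *)
Let near_ray h x (e : R) : continuous h -> 0 < e ->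
  \forall w \near (0 : 'rV[R]_m), forall t, 0 <= t <= 1 ->
    `|h (ray (w + x) t) - h (ray x t)| <= e.
Proof.
move=> ch e0.
have /compact_near_coveringP/(_ _ (nbhs (0 : 'rV[R]_m))
  (fun w t => `|h (ray (w + x) t) - h (ray x t)| <= e)) := @segment_compact R 0 1.
move=> H; suff : \forall w \near (0 : 'rV[R]_m), `[0, 1]%classic `<=`
    (fun t => `|h (ray (w + x) t) - h (ray x t)| <= e).
  by apply: filterS => w Hw t t01; apply: Hw; rewrite /= in_itv.
apply: H => t _; change (Real.sort R) in t.
have c1 : {for (t, 0 : 'rV[R]_m), continuous
   (fun z : R * 'rV[R]_m => h (ray (z.2 + x) z.1) - h (ray x z.1))}.
  apply: continuousB.
    apply: (@continuous_comp _ _ _ (fun z : R * 'rV[R]_m => ray (z.2 + x) z.1) h).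
      exact: ray_continuous2.
    exact: ch.
  apply: (@continuous_comp _ _ _ (fun z : R * 'rV[R]_m => ray x z.1) h); last exact: ch.
  by apply: (@continuous_comp _ _ _ fst (ray x)); [exact: cvg_fst|exact: ray_continuous].
move/cvgr_dist_le : c1 => /(_ e e0) /=.
rewrite add0r subrr; apply: filterS => z /=; by rewrite sub0r normrN.
Qed.

Lemma radial_integral_continuous j h : continuous h ->
  continuous (radial_integral j h).
Proof.
move=> ch x; apply/(@cvgrPdist_le _ _ _ (nbhs x)) => e e0.
apply/(@near_translate _ _ x); have := near_ray x ch e0.
apply: filterS => w Hw.
rewrite /= /radial_integral -unit_integralB; try exact: weight_continuous.
apply: unit_integral_le => [|t t01].
  by apply: continuous_sub; exact: weight_continuous.
rewrite -mulrBr normrM; have /andP[t0 t1] := t01.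
rewrite -[leRHS]mul1r ler_pM // ?normr_ge0 //.
  by rewrite ger0_norm ?exprn_ge0 // exprn_ile1.
by rewrite distrC; exact: Hw.
Qed.

(** Differentiation under the integral sign: the mean value theorem bounds the remainder by the
    oscillation of the partial derivatives along the ray, which [near_ray] makes small uniformly in
    [t]. *)
Lemma radial_integral_differentiable j h :
  (forall x, differentiable h x) -> (forall v, continuous ('D_v h)) ->
  forall x, differentiable (radial_integral j h) x /\
    forall v, 'D_v (radial_integral j h) x = radial_integral j.+1 ('D_v h) x.
Proof.
move=> dh cDh x.
have ch : continuous h by move=> y; exact: differentiable_continuous.
pose a i := radial_integral j.+1 ('D_(delta_mx 0 i) h) x.
have aE v : radial_integral j.+1 ('D_v h) x = \sum_i v 0 i * a i.
  rewrite /a /radial_integral.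
  rewrite -(@unit_integral_sum _ _ (fun i => v 0 i)
    (fun i t => t ^+ j.+1 * 'D_(delta_mx 0 i) h (ray x t))); last first.
    by move=> i; exact: (weight_continuous (cDh _)).
  congr unit_integral; apply/funext => t; rewrite derive_coord // mulr_sumr.
  by apply: eq_bigr => i _; rewrite /GRing.scale /=; ring.
suff H : forall e : R, 0 < e -> \forall w \near (0 : 'rV[R]_m),
    `|radial_integral j h (w + x) - radial_integral j h x - \sum_i w 0 i *: a i| <= e * `|w|.
  have [dr Dr] := differentiable_rV H.
  by split=> // v; rewrite Dr aE.
(* Each of the [m] coordinates contributes at most [d] times the norm of [w]; the divisor [m.+1]
   also covers [m = 0]. *)
move=> e e0; pose d := e / m.+1%:R.
have d0 : 0 < d by rewrite divr_gt0 // ltr0n.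
have : \forall w \near (0 : 'rV[R]_m), forall i t, 0 <= t <= 1 ->
    `|'D_(delta_mx 0 i) h (ray (w + x) t) - 'D_(delta_mx 0 i) h (ray x t)| <= d.
  have Hi i := near_ray x (cDh (delta_mx 0 i)) d0.
  exact: filter_forall Hi.
move=> /nbhs_norm0P[r /= r0 Hr]; apply/nbhs_norm0P; exists r => //= w wr.
rewrite -(aE w) /radial_integral -unit_integralB; try exact: weight_continuous.
rewrite -unit_integralB; last 2 first.
- by apply: continuous_sub; exact: weight_continuous.
- exact: (weight_continuous (cDh w)).
apply: unit_integral_le => [|t t01].
  apply: continuous_sub; last exact: (weight_continuous (cDh w)).
  by apply: continuous_sub; exact: weight_continuous.
have /andP[t0 t1] := t01.
(* For fixed [t] the segment runs from [ray x t] to [ray (w + x) t]. *)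
have [||s s01 Es] := @MVT_segment R (fun s => h (ray x t + s *: (t *: w)))
   (fun s => 'D_(t *: w) h (ray x t + s *: (t *: w))) 0 1 ler01.
- move=> s _; apply: is_derive_line; exact: diff_derivable.
- apply: continuous_subspaceT => s.
  apply: (@continuous_comp _ _ _ (fun s : R => ray x t + s *: (t *: w)) h); last exact: ch.
  apply: (@continuousD _ _ _ (fun=> ray x t) (fun s : R => s *: (t *: w))).
    exact: cst_continuous.
  by apply: continuousZr_tmp; exact: cvg_id.
move: Es; rewrite scale1r scale0r addr0 subr0 mulr1 -rayD => Es.
have Dt u : 'D_(t *: w) h u = t * 'D_w h u.
  by rewrite !deriveE // linearZ.
rewrite -mulrBr Es Dt exprSr -mulrA -mulrBr -mulrBr !normrM.
have tj : `|t ^+ j| <= 1 by rewrite ger0_norm ?exprn_ge0 // exprn_ile1.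
have t1' : `|t| <= 1 by rewrite ger0_norm.
have /andP[s0 s1] : 0 <= s <= 1 by move: s01; rewrite in_itv.
have Dle : `|'D_w h (ray x t + s *: (t *: w)) - 'D_w h (ray x t)| <= e * `|w|.
  (* The intermediate point lies on the ray towards [s *: w + x], whose displacement from [x] is no
     longer than [w]. *)
  have -> : ray x t + s *: (t *: w) = ray (s *: w + x) t.
    by rewrite rayD !scalerA mulrC.
  rewrite !(derive_coord w) // -sumrB.
  apply: (le_trans (ler_norm_sum _ _ _)).
  apply: (@le_trans _ _ (\sum_(i < m) d * `|w|)); last first.
    rewrite sumr_const card_ord -mulr_natl mulrA ler_wpM2r ?normr_ge0 //.
    by rewrite /d mulrCA ger_pMr // ler_pdivrMr ?ltr0n // mul1r ler_nat.
  apply: ler_sum => i _; rewrite -scalerBr normrZ mulrC.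
  apply: ler_pM; rewrite ?normr_ge0 //.
    apply: Hr => //=; rewrite normrZ (le_lt_trans _ wr) //.
    by rewrite ger0_norm // ler_piMl ?normr_ge0.
  rewrite [leRHS]/Num.norm /= mx_normrE.
  exact: (le_bigmax _ (fun ij : 'I_1 * 'I_m => `|w ij.1 ij.2|) (0, i)).
rewrite -[leRHS]mul1r ler_pM ?mulr_ge0 // -[leRHS]mul1r ler_pM //.
Qed.

Let Ck_continuous (h : 'rV[R]_m -> R) k : Ck k setT h -> continuous h.
Proof. by elim: k h => [|k IH] h Ch x; [exact: Ch|apply: IH; exact: CkW]. Qed.

Lemma Ck_radial_integral k j h : Ck k setT h -> Ck k setT (radial_integral j h).
Proof.
elim: k j h => [|k IH] j h Ch.
  by move=> x _; apply: radial_integral_continuous => y; exact: Ch.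
have [dh Dh] := Ch.
have cD v : continuous ('D_v h) by exact: Ck_continuous (Dh v).
have H x := @radial_integral_differentiable j h (fun y => dh y I) cD x.
split=> [x _|v]; first exact: (H x).1.
apply: (Ck_congr openT _ (IH j.+1 _ (Dh v))) => x _.
by rewrite (H x).2.
Qed.

(* Hadamard's lemma: the coefficients of [x - c] are smooth in [x]. *)
Lemma radial_integral_expansion h x : Ck 1 setT h ->
  h x = h c + \sum_i (x - c) 0 i * radial_integral 0 ('D_(delta_mx 0 i) h) x.
Proof.
move=> Ch; have [dh Dh] := Ch.
have cD v : continuous ('D_v h) by move=> y; exact: Dh.
rewrite -(@unit_integral_sum _ _ (fun i => (x - c) 0 i)
    (fun i t => t ^+ 0 * 'D_(delta_mx 0 i) h (ray x t))); last first.
  by move=> i; exact: (weight_continuous (cD _)).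
have -> : (fun t => \sum_i (x - c) 0 i * (t ^+ 0 * 'D_(delta_mx 0 i) h (ray x t)))
  = (fun t => t ^+ 0 * 'D_(x - c) h (ray x t)).
  apply/funext => t; rewrite derive_coord; last exact: dh.
  by rewrite mulr_sumr; apply: eq_bigr => i _; rewrite expr0 !mul1r.
(* Along the ray the integrand is the derivative of [h], so it integrates to the difference of [h]
   at the two ends. *)
have Dline t : is_derive t 1 (fun t : R => h (ray x t))
    (t ^+ 0 * 'D_(x - c) h (ray x t)).
  by rewrite expr0 mul1r; apply: is_derive_line; apply: diff_derivable; exact: dh.
rewrite (unit_integral_derive (weight_continuous (cD _)) Dline).
by rewrite /ray scale1r scale0r addr0 addrCA subrr addr0 addrCA subrr addr0.
Qed.

End RadialIntegral.

(** * Bump functions and extension *)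

Section FlatFunction.
Context {R : realType}.
Implicit Types x y : R.

(* The usual exp(-1/x), with the powers of 1/x that its derivatives produce. *)
Definition flat (k : nat) x : R :=
  if 0 < x then x^-1 ^+ k * expR (- x^-1) else 0.

Lemma flat_npos k x : x <= 0 -> flat k x = 0.
Proof. by move=> x0; rewrite /flat ltNge x0. Qed.

Lemma flat0_gt0 x : 0 < x -> 0 < flat 0 x.
Proof. by move=> x0; rewrite /flat x0 expr0 mul1r expR_gt0. Qed.

(** For positive k and z = y / k, raise z <= exp z to the power k. *)
Let expr_expR_le k y : 0 < y -> y ^+ k * expR (- y) <= k%:R ^+ k.
Proof.
move=> y0; rewrite expRN ler_pdivrMr ?expR_gt0 //.
case: k => [|k]; first by rewrite !expr0 mul1r (ltW _) // expR_gt1.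
have k0 : 0 < k.+1%:R :> R by rewrite ltr0n.
have {2}-> : y = k.+1%:R * (y / k.+1%:R) by rewrite mulrCA divff ?mulr1 // gt_eqF.
rewrite expRM_natl -exprMn lerXn2r ?nnegrE ?mulr_ge0 ?expR_ge0 ?(ltW y0) //.
rewrite -ler_pdivrMl // mulrC (le_trans _ (expR_ge1Dx _)) //.
by rewrite lerDr.
Qed.

(** Spending two more powers of 1/x leaves a factor x^2, which forces the derivative at 0 to
    vanish. *)
Let flat_le_sqr k x : `|flat k x| <= k.+2%:R ^+ k.+2 * x ^+ 2.
Proof.
have [x0|x0] := leP x 0.
  by rewrite flat_npos // normr0 mulr_ge0 ?sqr_ge0 // exprn_ge0.
have xk : x^-1 ^+ k.+2 * x ^+ 2 = x^-1 ^+ k.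
  by rewrite -addn2 exprD -mulrA -exprMn mulVf ?gt_eqF // expr1n mulr1.
rewrite /flat x0 ger0_norm ?mulr_ge0 ?expR_ge0 ?exprn_ge0 ?invr_ge0 ?(ltW x0) //.
rewrite -xk mulrAC ler_wpM2r ?sqr_ge0 //.
by apply: expr_expR_le; rewrite invr_gt0.
Qed.

(** The terms come from differentiating exp(-1/x) and x^-k; the result is again a combination of the
    family [flat]. *)
Definition flat_derivative k x := flat k.+2 x - k%:R * flat k.+1 x.

Lemma is_derive_flat k x : is_derive x 1 (flat k) (flat_derivative k x).
Proof.
rewrite /flat_derivative; have [x0|x0|->] := ltgtP x 0.
- rewrite !flat_npos ?ltW // mulr0 subr0.
  apply: (near_eq_is_derive _ (is_derive_cst (0 : R) x 1)).
  by near=> y; rewrite flat_npos // ltW //; near: y; exact: lt_nbhsl.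
- have H : is_derive x 1 (fun y : R => y^-1 ^+ k * expR (- y^-1))
      (flat k.+2 x - k%:R * flat k.+1 x).
    have d1 : is_derive x 1 (fun y : R => y^-1) (- x ^- 2 *: 1).
      by apply: is_deriveV; rewrite gt_eqF.
    have d2 := is_deriveX k d1.
    have d3 := @is_derive1_comp _ expR (fun y : R => - y^-1) x _ _
      (is_derive_expR (- x^-1)) (is_deriveN d1).
    have -> : (fun y : R => y^-1 ^+ k * expR (- y^-1)) =
        (fun y : R => y^-1) ^+ k * (expR \o (fun y : R => - y^-1)).
      by apply/funext => y; rewrite !fctE.
    apply: (is_derive_eq (is_deriveM d2 d3)).
    rewrite /flat x0 /GRing.scale /=.
    have -> : ((fun y : R => y^-1) ^+ k) x = x^-1 ^+ k by rewrite fctE.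
    have -> : x ^- 2 = x^-1 ^+ 2 by rewrite exprVn.
    case: (k) => [|j] /=; rewrite ?exprS; ring.
  apply: near_eq_is_derive H.
  by near=> y; rewrite /flat ifT //; near: y; exact: lt_nbhsr.
- rewrite flat_npos // flat_npos // mulr0 subr0.
  pose L : {linear R -> R} := HB.pack (fun _ : R => 0 : R)
    (GRing.isLinear.Build _ _ _ _ (fun _ : R => 0 : R)
      (fun a _ _ => esym (etrans (addr0 _) (mulr0 a)))).
  have cL : continuous L by exact: cst_continuous.
  suff H : forall e : R, 0 < e ->
      \forall w \near (0 : R), `|flat k (w + 0) - flat k 0 - L w| <= e * `|w|.
    have [df Df] := differentiable_linear cL H.
    by apply: DeriveDef; [exact: diff_derivable|exact: Df].
  move=> e e0; pose C : R := k.+2%:R ^+ k.+2.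
  have C0 : 0 < C by rewrite exprn_gt0 // ltr0n.
  apply/nbhs_norm0P; exists (e / C) => [/=|w /= we]; first by rewrite divr_gt0.
  rewrite (@flat_npos k 0) // addr0 !subr0 (le_trans (flat_le_sqr _ _)) //.
  rewrite -/C -[in X in X <= _]real_normK ?num_real // mulrA ler_wpM2r ?normr_ge0 //.
  by rewrite mulrC -ler_pdivlMr // ltW.
Unshelve. all: by end_near. Qed.

(** The induction on [k] runs over all [j] at once, since each derivative involves the next two
    members of the family. *)
Lemma Ck_flat k j m (U : set 'rV[R]_m) (u : 'rV[R]_m -> R) :
  open U -> Ck k U u -> Ck k U (flat j \o u).
Proof.
move=> oU; have df i y : differentiable (flat i) y.
  by apply/derivable1_diffP; case: (is_derive_flat i y).
elim: k j u => [|k IH] j u Cu.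
  move=> x Ux; apply: continuous_comp; first exact: Cu.
  exact/differentiable_continuous.
have [du Du] := Cu; split=> [x Ux|v].
  by apply: differentiable_comp; [exact: du|exact: df].
pose w := (flat j.+2 \o u) + (fun=> - j%:R) * (flat j.+1 \o u).
have Cw : Ck k U w.
  apply: Ck_add => //; first exact/IH/CkW.
  by apply: Ck_mul => //; [exact: Ck_cst|exact/IH/CkW].
apply: (Ck_congr oU _ (Ck_mul oU Cw (Du v))) => x Ux.
have -> : 'D_v (flat j \o u) x = 'D_v u x *: 'D_1 (flat j) (u x).
  rewrite [LHS]deriveE; last by apply: differentiable_comp; [exact: du|exact: df].
  rewrite diff_comp /=; [|exact: du|exact: df].
  rewrite [in RHS]deriveE ?[in RHS](deriveE _ (df j (u x))); last exact: du.
  by rewrite -linearZ /GRing.scale /= mulr1.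
rewrite (@derive_val _ _ _ _ _ _ _ (is_derive_flat j (u x))).
by rewrite /w /flat_derivative !fctE /= /GRing.scale /= mulrC mulNr.
Qed.

End FlatFunction.

(** * Inverses, coordinates and bump functions on the coordinate space *)

Lemma Ck_inv {R : realType} k m (U : set 'rV[R]_m) (f : 'rV[R]_m -> R) :
  open U -> (forall x, U x -> f x != 0) -> Ck k U f -> Ck k U (fun x => (f x)^-1).
Proof.
move=> oU f0; elim: k => [|k IH] Cf.
  by move=> x Ux; apply: continuousV; [exact: f0|exact: Cf].
have Ci := IH (CkW Cf); have [df Df] := Cf; split=> [x Ux|v].
  by apply: differentiableV; [exact: df|exact: f0].
apply: (Ck_congr oU _ (Ck_mul oU (@Ck_cst _ k m R U (-1))
  (Ck_mul oU (Ck_mul oU Ci Ci) (Df v)))) => x Ux.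
rewrite !fctE deriveV; [|exact: f0|exact/diff_derivable/df].
by rewrite /GRing.scale /= mulN1r mulNr -exprVn expr2.
Qed.

Lemma Ck_coordinate {R : realType} k m (U : set 'rV[R]_m) (i : 'I_m) :
  open U -> Ck k U (fun x : 'rV[R]_m => x 0 i).
Proof.
move=> oU; move: i; apply/(Ck_coord k (fun x => x) oU).
case: k => [|k]; first by move=> x _; exact: cvg_id.
split=> [x _|v]; first exact: ex_diff.
apply: (Ck_congr oU _ (Ck_cst k U v)) => x _.
by rewrite derive_id.
Qed.

(** The function [psi] is positive at [c] and vanishes outside a cube; a second flat function turns
    it into the constant 1 where it exceeds half its value at [c]. *)
Lemma rV_bump {R : realType} m (c : 'rV[R]_m) (V : set 'rV[R]_m) : open V -> V c ->
  exists (phi : 'rV[R]_m -> R) (K : set 'rV[R]_m),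
    [/\ smooth_on setT phi, compact K, K `<=` V,
        (forall x, ~ K x -> phi x = 0) & \forall x \near c, phi x = 1].
Proof.
move=> oV Vc.
have /nbhs_ballP[e /= e0 eV] : nbhs c V by exact: open_nbhs_nbhs.
(* Half the radius keeps the closed cube inside the open ball of the sup norm. *)
pose r := e / 2; have r0 : 0 < r by rewrite divr_gt0.
pose q (x : 'rV[R]_m) := \sum_i (x 0 i - c 0 i) ^+ 2.
pose psi := flat 0 \o (fun x => r ^+ 2 + (-1) * q x).
pose a := flat 0 (r ^+ 2) / 2.
have a0 : 0 < a by rewrite divr_gt0 // flat0_gt0 // exprn_gt0.
(* The second term is -1 where [psi] is 0, and 0 where [psi] is at least [a]. *)
pose phi x := 1 + (- (flat 0 1)^-1) * (flat 0 \o (fun x => 1 + (- a^-1) * psi x)) x.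
have Cpsi k : Ck k setT psi.
  apply: Ck_flat; first exact: openT.
  apply: (Ck_add openT (Ck_cst k setT (r ^+ 2))).
  apply: (Ck_mul openT (Ck_cst k setT (-1 : R))).
  apply: Ck_sum; first exact: openT.
  move=> i; have Ci : Ck k setT (fun x : 'rV[R]_m => x 0 i - c 0 i).
    apply: (Ck_add openT); last exact: (Ck_cst k setT (- c 0 i)).
    exact: Ck_coordinate openT.
  exact: (Ck_mul openT Ci Ci).
have Cphi k : Ck k setT phi.
  apply: (Ck_add openT (Ck_cst k setT (1 : R))).
  apply: (Ck_mul openT (Ck_cst k setT (- (flat 0 1)^-1 : R))).
  apply: Ck_flat; first exact: openT.
  apply: (Ck_add openT (Ck_cst k setT (1 : R))).
  exact: (Ck_mul openT (Ck_cst k setT (- a^-1 : R))).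
exists phi, [set x | forall i, `[c 0 i - r, c 0 i + r]%classic (x 0 i)].
split=> //.
- apply: (rV_compact (A := fun i => `[c 0 i - r, c 0 i + r]%classic)) => i.
  exact: segment_compact.
- move=> x /= Kx; apply: eV; rewrite mx_norm_ball /= /Num.norm /= mx_normrE.
  apply: (@le_lt_trans _ _ r); last by rewrite /r gtr_pMr // invf_lt1 ?ltr1n // ltr0n.
  apply/bigmax_leP; split=> [|[i j] _]; first exact: ltW.
  rewrite !mxE /= ord1 distrC ler_distl; have := Kx j.
  by rewrite in_itv.
- move=> x /= /existsNP[i nKi].
  have qr : r ^+ 2 <= q x.
    rewrite /q (bigD1 i) //= -[leLHS]addr0 lerD ?sumr_ge0 // => [|j _]; last exact: sqr_ge0.
    rewrite -[leRHS]real_normK ?num_real // lerXn2r ?nnegrE ?(ltW r0) //.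
    rewrite leNgt; apply/negP => lt_r; apply: nKi; rewrite in_itv /=.
    by rewrite -ler_distl ltW.
  rewrite /phi /= /psi /= (@flat_npos _ 0 (r ^+ 2 + -1 * q x)).
    by rewrite mulr0 addr0 mulNr mulVf ?subrr // gt_eqF // flat0_gt0.
  by rewrite mulN1r subr_le0.
- have cpsi : {for c, continuous psi} by exact: (Cpsi 0).
  have psic : psi c = flat 0 (r ^+ 2).
    rewrite /psi /= /q big1 ?mulr0 ?addr0 // => i _.
    by rewrite subrr expr0n.
  have : \forall x \near c, a < psi x.
    move/cvgr_gt : cpsi; apply; rewrite psic /a gtr_pMr ?flat0_gt0 ?exprn_gt0 //.
    by rewrite invf_lt1 ?ltr1n // ltr0n.
  apply: filterS => x ax.
  rewrite /phi /= (@flat_npos _ 0 (1 + - a^-1 * psi x)) ?mulr0 ?addr0 //.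
  by rewrite mulNr subr_le0 mulrC ler_pdivlMr // mul1r ltW.
Qed.

(** * Bump functions on a manifold *)

Section Bump.
Context {R : realType} {n : nat} {M : manifold R n}.
Implicit Types (U V : set M) (p q : M).
Local Notation K c := (chart_of c).

(** The bump of the chart is continued by zero; its compact support is closed because [M] is
    Hausdorff, so the complement [W] is open. The cover by [V] and [W] is the form in which data on
    [V], multiplied by [phi], are glued with zero. *)
Lemma bump p V : open V -> V p ->
  exists (phi : Cinf M) (W : set M),
    [/\ open W, (forall q, V q \/ W q), (forall q, W q -> phi q = 0)
      & \forall q \near p, phi q = 1].
Proof.
move=> oV Vp; pose c := chart_at p; have cp : cdom (K c) p := chart_atP p.
have [phi [A [sphi cA AV phi0 phi1]]] :=
  rV_bump (chart_image_open (c := c) oV) (chart_imageP cp Vp).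
pose B := cinv (K c) @` A.
have AcB q : cdom (K c) q -> A (K c q) -> B q.
  by move=> cq Aq; exists (K c q) => //; rewrite cmapK.
have oB : open (~` B).
  apply: closed_openC; apply: compact_closed; first exact: manifold_hausdorff.
  apply: continuous_compact => //; apply: continuous_in_subspaceT => x.
  by rewrite inE => Ax; apply: cinv_continuous; exact: (AV x Ax).1.
pose Phi q := if `[< cdom (K c) q >] then phi (K c q) else 0.
have Phic q : cdom (K c) q -> Phi q = phi (K c q).
  by move=> cq; rewrite /Phi asboolT.
have Phi0 q : (~` B) q -> Phi q = 0.
  move=> nBq; rewrite /Phi; case: asboolP => // cq.
  by apply: phi0 => Aq; apply: nBq; exact: AcB.
have sPhi : smooth setT Phi.
  apply: smooth_local => q _; have [Bq|nBq] := pselect (B q).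
    have cq : cdom (K c) q.
      by have [x Ax <-] := Bq; apply: cinv_dom; exact: (AV x Ax).1.
    exists (cdom (K c)) => //.
    have := smooth_comp_chart c openT sphi; rewrite preimage_setT setIT.
    by apply: smooth_congr; [exact: cdom_open|move=> z cz; rewrite Phic].
  exists (~` B) => //; apply: (smooth_congr oB _ (smooth_cst _ 0)) => z Bz.
  by rewrite Phi0.
exists (MkCinf sPhi), (~` B); split=> //.
- move=> q; have [[x Ax <-]|] := pselect (B q); last by right.
  by left; have [] := AV x Ax.
- have : \forall q \near p, cdom (K c) q.
    by apply: open_nbhs_nbhs; split=> //; exact: cdom_open.
  have : \forall q \near p, phi (K c q) = 1 by exact: (cmap_continuous cp phi1).
  by apply: filterS2 => q q1 cq; rewrite /= Phic.
Qed.

End Bump.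

Lemma near_openP (T : topologicalType) (p : T) (P : T -> Prop) :
  (\forall q \near p, P q) ->
  exists V : set T, [/\ open V, V p & forall q, V q -> P q].
Proof. by rewrite /prop_near1 nbhsE => -[V [oV Vp] VP]; exists V. Qed.


(** * Extension of local functions and sections *)

Section Extension.
Context {R : realType} {n : nat} {M : manifold R n}.
Implicit Types (U V : set M) (p q : M).

Lemma smooth_inv U (f : M -> R) : open U -> (forall p, U p -> f p != 0) ->
  smooth U f -> smooth U (fun p => (f p)^-1).
Proof.
move=> oU f0 sf c k; apply: Ck_inv; [exact: chart_image_open| |exact: sf].
by move=> x [_ Ux]; exact: f0.
Qed.

(** The function is cut off by a bump and continued by zero, so agreement is only claimed near
    [p]. *)
Lemma extend_function p V (f : M -> R) : open V -> V p -> smooth V f ->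
  exists F : Cinf M, \forall q \near p, F q = f q.
Proof.
move=> oV Vp sf; have [phi [W [oW VW W0 phi1]]] := bump oV Vp.
have sF : smooth setT (fun q => phi q * f q).
  apply: smooth_local => q _; have [Vq|Wq] := VW q.
    exists V => //; apply: (smooth_mul oV) => //.
    by apply: smoothS (Cinf_smooth phi).
  exists W => //; apply: (smooth_congr oW _ (smooth_cst _ 0)) => z Wz.
  by rewrite W0 // mul0r.
by exists (MkCinf sF); move: phi1; apply: filterS => q /= ->; rewrite mul1r.
Qed.

Context {r : nat} {E : vector_bundle M r}.
Implicit Types (s : forall q, E q).

Lemma tmap_scale i p (a : R) (v : E p) : tdom E i p ->
  tmap E i p (a *: v) = a *: tmap E i p v.
Proof.
move=> ip; have tl := tmap_linear ip.
have t0 : tmap E i p 0 = 0.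
  by have := tl (-1) 0 0; rewrite scaler0 addr0 scaleN1r addNr.
by have := tl a v 0; rewrite !addr0 t0 addr0.
Qed.

Lemma tinv_linear i p : tdom E i p -> linear (tinv E i p).
Proof.
move=> ip b u v; apply: (can_inj (tmapK ip)).
by rewrite (tmap_linear ip) !(tinvK ip).
Qed.

Lemma smooth_section_scale V (f : M -> R) s : open V ->
  smooth V f -> smooth_section V s -> smooth_section V (fun q => f q *: s q).
Proof.
move=> oV sf ss i; have oVi : open (V `&` tdom E i).
  by apply: openI => //; exact: tdom_open.
have sfi : smooth (V `&` tdom E i) f by apply: smoothS sf => q [].
apply: (smooth_congr oVi _ (smooth_scale oVi sfi (ss i))) => q [_ iq].
by rewrite tmap_scale.
Qed.

Lemma extend_section p V s : open V -> V p -> smooth_section V s ->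
  exists X : Sec E, \forall q \near p, X q = s q.
Proof.
move=> oV Vp ss; have [phi [W [oW VW W0 phi1]]] := bump oV Vp.
have sphi : smooth V phi by apply: smoothS (Cinf_smooth phi).
have sF : smooth_section setT (fun q => phi q *: s q).
  move=> i; apply: smooth_local => q [_ iq]; have [Vq|Wq] := VW q.
    by exists (V `&` tdom E i) => //; exact: smooth_section_scale.
  have oWi : open (W `&` tdom E i) by apply: openI => //; exact: tdom_open.
  exists (W `&` tdom E i) => //.
  apply: (smooth_congr oWi _ (smooth_cst _ 0)) => z [Wz iz].
  by rewrite tmap_scale // W0 // scale0r.
by exists (MkSec sF); move: phi1; apply: filterS => q /= ->; rewrite scale1r.
Qed.

Lemma smooth_section_tinv i (v : 'rV[R]_r) :
  smooth_section (tdom E i) (fun q => tinv E i q v).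
Proof. by move=> j; exact: triv_transition. Qed.

(** Lets identities in a fiber be tested on global sections. *)
Lemma section_through p (v : E p) : exists X : Sec E, X p = v.
Proof.
have [i ip] := tdom_cover E p.
have [X /nbhs_singleton Xp] :=
  extend_section (tdom_open i) ip (smooth_section_tinv i (tmap E i p v)).
by exists X; rewrite Xp tmapK.
Qed.

Lemma CinfDE (f g : Cinf M) p : (f + g) p = f p + g p. Proof. by []. Qed.
Lemma CinfME (f g : Cinf M) p : (f * g) p = f p * g p. Proof. by []. Qed.
Lemma CinfNE (f : Cinf M) p : (- f) p = - f p.
Proof. exact: mulN1r. Qed.
Lemma Cinf0E p : (0 : Cinf M) p = 0. Proof. by []. Qed.
Lemma Cinf_cstE a p : Cinf_cst a p = a :> R. Proof. by []. Qed.
Lemma Cinf_sumE (I : finType) (f : I -> Cinf M) p :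
  (\sum_i f i) p = \sum_i f i p.
Proof. by elim/big_rec2 : _ => // i y1 y2 _ <-. Qed.

Lemma SecDE (X Y : Sec E) p : (X + Y) p = X p + Y p. Proof. by []. Qed.
Lemma SecZE (f : Cinf M) (X : Sec E) p : (f *: X) p = f p *: X p. Proof. by []. Qed.
Lemma Sec0E p : (0 : Sec E) p = 0. Proof. by []. Qed.
Lemma SecNE (X : Sec E) p : (- X) p = - X p.
Proof. exact: scaleN1r. Qed.

End Extension.

(** * Point derivations and tangent vectors *)

Section PointDerivation.
Context {R : realType} {n : nat} {M : manifold R n}.
Implicit Types (U V : set M) (p q : M) (f g : Cinf M) (D : Cinf M -> R).
Local Notation K c := (chart_of c).

(** With the Leibniz rule, the last clause gives homogeneity under real scalars. *)
Definition point_derivation p D : Prop :=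
  [/\ forall f g, D (f + g) = D f + D g,
      forall f g, D (f * g) = f p * D g + g p * D f
    & forall a, D (Cinf_cst a) = 0].

(** A bump [phi] with [phi p = 1] gives [phi * f = phi * g]; in the Leibniz rule the terms with
    [D phi] agree and cancel. *)
Lemma point_derivation_near p D f g : point_derivation p D ->
  (\forall q \near p, f q = g q) -> D f = D g.
Proof.
move=> [DD DM Dc] /near_openP[V [oV Vp VE]].
have [phi [W [oW VW W0 /nbhs_singleton phi1]]] := bump oV Vp.
have E : phi * f = phi * g.
  apply: Cinf_eq => q; rewrite !CinfME.
  by have [/VE->//|/W0->] := VW q; rewrite !mul0r.
have := congr1 D E; rewrite !DM phi1 !mul1r (VE p Vp).
by move/addIr.
Qed.

Lemma chart_coord_smooth c i : smooth (cdom (K c)) (@chart_coord R n M c i).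
Proof.
by move: i; apply/(smooth_coord _ (cdom_open (K c))); exact: chart_transition_smooth.
Qed.

Lemma extend_coordinates c p : cdom (K c) p -> exists x : 'I_n -> Cinf M,
  \forall q \near p, forall i, x i q = chart_coord c i q.
Proof.
move=> cp.
have H i := extend_function (cdom_open (K c)) cp (@chart_coord_smooth c i).
have [x Hx] := choice H.
by exists x; exact: filter_forall Hx.
Qed.

Lemma hadamard c p (x : 'I_n -> Cinf M) f : cdom (K c) p ->
  (\forall q \near p, forall i, x i q = chart_coord c i q) ->
  exists g : 'I_n -> Cinf M, \forall q \near p,
    f q = (Cinf_cst (f p) + \sum_i (x i - Cinf_cst (x i p)) * g i) q.
Proof.
move=> cp xE.
have [phi [A [sphi cA AV phi0 phi1]]] := rV_bump (@cran_open _ _ _ (K c)) (cmap_ran cp).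
(* The cut-off makes the chart expression smooth on the whole coordinate space, since rays from
   [K c p] may leave the range of the chart. *)
pose h (y : 'rV[R]_n) := phi y * (f (cinv (K c) y)).
have sh k : Ck k setT h.
  apply: Ck_local => y _; have [Ay|nAy] := pselect (A y).
    exists (cran (K c)); first exact: AV.
    apply: Ck_mul; first exact: cran_open.
      exact: CkS (@subsetT _ _) (sphi k).
    apply: CkS (Cinf_smooth f c k) => z rz; by split.
  have oA : open (~` A).
    by apply: closed_openC; apply: compact_closed => //; exact: norm_hausdorff.
  exists (~` A) => //; apply: (Ck_congr oA _ (Ck_cst k _ 0)) => z nAz.
  by rewrite /h phi0 // mul0r.
pose G i := radial_integral (K c p) 0 ('D_(delta_mx 0 i) h).
have sG i : smooth (cdom (K c)) (G i \o K c).
  have sGi : smooth_on setT (G i).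
    by move=> k; apply: Ck_radial_integral; exact: (sh k.+1).2.
  by have := smooth_comp_chart c openT sGi; rewrite preimage_setT setIT.
have [g gE] := choice (fun i => extend_function (cdom_open (K c)) cp (sG i)).
have {}gE : \forall q \near p, forall i, g i q = (G i \o K c) q by exact: filter_forall gE.
exists g.
have cpn : \forall q \near p, cdom (K c) q.
  by apply: open_nbhs_nbhs; split=> //; exact: cdom_open.
have phin : \forall q \near p, phi (K c q) = 1 by exact: (cmap_continuous cp phi1).
near=> q; have cq : cdom (K c) q by near: q.
have fE z : cdom (K c) z -> phi (K c z) = 1 -> f z = h (K c z).
  by move=> cz z1; rewrite /h z1 mul1r cmapK.
rewrite CinfDE Cinf_sumE (fE q) //; last by near: q.
rewrite (radial_integral_expansion (K c p) (K c q) (sh 1)) -fE //; last first.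
  exact: nbhs_singleton phin.
congr (_ + _); apply: eq_bigr => i _; rewrite CinfME CinfDE CinfNE.
rewrite (near gE q) // (near xE q) // (nbhs_singleton xE) /chart_coord.
by rewrite !mxE.
Unshelve. all: by end_near. Qed.

(** The coefficients are the values at [p] of the Hadamard quotients of [f], hence the same for
    every [D]: a derivation is determined by its values on the coordinates. *)
Lemma point_derivation_expansion c p (x : 'I_n -> Cinf M) f : cdom (K c) p ->
  (\forall q \near p, forall i, x i q = chart_coord c i q) ->
  exists b : 'I_n -> R, forall D, point_derivation p D -> D f = \sum_i D (x i) * b i.
Proof.
move=> cp xE; have [g gE] := hadamard f cp xE.
exists (fun i => g i p) => D Dp; rewrite (point_derivation_near Dp gE).
have [DD DM Dc] := Dp.
have D0 : D 0 = 0 by exact: (Dc 0).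
have -> : D (Cinf_cst (f p) + \sum_i (x i - Cinf_cst (x i p)) * g i) =
    \sum_i D ((x i - Cinf_cst (x i p)) * g i).
  by rewrite DD Dc add0r; elim/big_rec2 : _ => // i y1 y2 _ <-; rewrite DD.
apply: eq_bigr => i _; rewrite DM CinfDE CinfNE /= subrr mul0r add0r mulrC.
by rewrite DD -[- Cinf_cst _]/(Cinf_cst (-1) * _) DM !Dc !mulr0 !addr0.
Qed.

End PointDerivation.

(** * Derivations at a point as tangent vectors *)

Section TangentVectors.
Context {R : realType} {n : nat} {M : manifold R n}.
Implicit Types (U V : set M) (p q : M).
Local Notation K c := (chart_of c).

Lemma dfun_near p (f g : M -> R) (v : TM M p) :
  (\forall q \near p, f q = g q) -> dfun f v = dfun g v.
Proof.
move=> fg; apply: near_eq_derive.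
have kp := chart_atP p; have rp := cmap_ran kp.
have : nbhs (cinv (K (chart_at p)) (K (chart_at p) p)) [set q | f q = g q].
  by rewrite cmapK.
exact: cinv_continuous.
Qed.

Let smooth_differentiable U (f : M -> R) p : open U -> smooth U f -> U p ->
  differentiable (f \o cinv (K (chart_at p))) (K (chart_at p) p).
Proof. by move=> oU sf Up; exact: (sf _ 1%N).1 (chart_imageP (chart_atP p) Up). Qed.

Lemma dfun_linear U (f : M -> R) p : open U -> smooth U f -> U p ->
  scalar (fun v : TM M p => dfun f v).
Proof.
move=> oU sf Up a u v; have df := smooth_differentiable oU sf Up.
by rewrite /dfun !deriveE // linearP.
Qed.

Lemma dfun_cst p (a : R) (v : TM M p) : dfun (fun=> a) v = 0.
Proof. exact: derive_cst. Qed.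

Lemma dfun_point_derivation p (v : TM M p) :
  point_derivation p (fun f : Cinf M => dfun f v).
Proof.
have df (f : Cinf M) :=
  diff_derivable (smooth_differentiable openT (Cinf_smooth f) (I : setT p)).
have kp := chart_atP p.
split=> [f g|f g|a]; last exact: dfun_cst.
  exact: (deriveD (df v f) (df v g)).
rewrite /dfun; have := deriveM (df v f) (df v g).
by rewrite /= cmapK.
Qed.

Lemma dfun_chart_coord c i p (v : TM M p) : cdom (K c) p ->
  dfun (chart_coord c i) v = tmap (TM M) c p v 0 i.
Proof.
move=> cp; rewrite (dfun_chart _ (cdom_open (K c)) (@chart_coord_smooth _ _ _ c i) cp cp).
set w := tmap _ _ _ _.
transitivity ('D_w (fun x : 'rV[R]_n => x 0 i) (K c p)).
  apply: near_eq_derive; apply: (@near_open _ (cran (K c))).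
  - exact: cran_open.
  - exact: cmap_ran.
  - by move=> x rx; rewrite /= /chart_coord cinvK.
by have := derive_id (K c p) w; rewrite derive_mx // => /matrixP/(_ 0 i); rewrite mxE.
Qed.

(** Coordinate functions, extended to all of [M], already separate tangent vectors. *)
Lemma tangent_eq p (v w : TM M p) :
  (forall f : Cinf M, dfun f v = dfun f w) -> v = w.
Proof.
move=> vw; have kp := chart_atP p.
have [x xE] := extend_coordinates kp.
apply: (can_inj (@tmapK _ _ _ _ (TM M) (chart_at p) p kp)).
apply/rowP => i; rewrite -(dfun_chart_coord i v kp) -(dfun_chart_coord i w kp).
have xi : \forall q \near p, x i q = chart_coord (chart_at p) i q.
  by move: xE; apply: filterS => q; exact.
by rewrite -(dfun_near v xi) -(dfun_near w xi) vw.
Qed.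

(** The vector with chart coordinates [D (x i)] agrees with [D] on the coordinates, hence on all
    functions. *)
Lemma point_derivation_tangent p (D : Cinf M -> R) : point_derivation p D ->
  exists v : TM M p, forall f : Cinf M, D f = dfun f v.
Proof.
move=> Dp; have kp := chart_atP p; have [x xE] := extend_coordinates kp.
exists (tinv (TM M) (chart_at p) p (\row_i D (x i))) => f.
have [b bE] := point_derivation_expansion f kp xE.
rewrite (bE _ Dp) (bE _ (dfun_point_derivation _)).
apply: eq_bigr => i _; congr (_ * _).
have xi : \forall q \near p, x i q = chart_coord (chart_at p) i q.
  by move: xE; apply: filterS => q; exact.
by rewrite (dfun_near _ xi) dfun_chart_coord // tinvK // mxE.
Qed.

(** Near each point the components of [G] in a chart are the smooth functions [D (x i)]. *)
Lemma smooth_vector_field V (G : forall p, TM M p) : open V ->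
  (forall p, V p -> exists D : Cinf M -> Cinf M,
     \forall q \near p, forall f : Cinf M, D f q = dfun f (G q)) ->
  smooth_section V G.
Proof.
move=> oV H c; apply: smooth_local => p [Vp cp].
have [D DE] := H p Vp; have [x xE] := extend_coordinates cp.
have [W [oW Wp WE]] := near_openP DE.
have [W' [oW' Wp' WE']] := near_openP xE.
exists (W `&` W' `&` cdom (K c)); first by [].
have oO : open (W `&` W' `&` cdom (K c)).
  by apply: openI; [exact: openI|exact: cdom_open].
apply/(smooth_coord _ oO) => i.
have sD : smooth (W `&` W' `&` cdom (K c)) (D (x i)).
  by apply: smoothS (Cinf_smooth (D (x i))).
apply: (smooth_congr oO _ sD) => q [[Wq Wq'] cq].
rewrite WE // -dfun_chart_coord //; apply: dfun_near.
by apply: (near_open oW' Wq') => z Wz; exact: WE'.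
Qed.

End TangentVectors.

(** * Derivations and biderivations in coordinates *)

Section TangentCoordinates.
Context {R : realType} {n : nat} {M : manifold R n}.
Implicit Types (p : M).

(** The coefficients are found by applying the same expansion to the basis vectors, which are dual
    to the coordinates of the selected chart. *)
Lemma point_derivation_coord p : exists x : 'I_n -> Cinf M,
  forall D, point_derivation p D -> forall f : Cinf M,
    D f = \sum_i D (x i) * dfun f (delta_mx 0 i : TM M p).
Proof.
have kp := chart_atP p; have [x xE] := extend_coordinates kp.
exists x => D Dp f; have [b bE] := point_derivation_expansion f kp xE.
rewrite (bE _ Dp); apply: eq_bigr => i _; congr (_ * _).
rewrite (bE _ (dfun_point_derivation _)).
have xij j : dfun (x j) (delta_mx 0 i : TM M p) = (j == i)%:R.
  have xj : \forall q \near p, x j q = chart_coord (chart_at p) j q.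
    by move: xE; apply: filterS => q; exact.
  by rewrite (dfun_near _ xj) dfun_chart_coord // /= /ttmap jac_id // mxE eqxx.
rewrite (bigD1 i) //= xij eqxx mul1r big1 ?addr0 // => j ji.
by rewrite xij (negPf ji) mul0r.
Qed.

(** The expansion is applied in the second argument; skew-symmetry carries it to the first. *)
Lemma biderivation_matrix p (B : Cinf M -> Cinf M -> R) :
  (forall f, point_derivation p (B f)) -> (forall f g, B f g = - B g f) ->
  exists A : 'M[R]_n, A^T = - A /\ forall f g : Cinf M,
    B f g = \sum_i \sum_j A i j * dfun f (delta_mx 0 i : TM M p)
                                * dfun g (delta_mx 0 j : TM M p).
Proof.
move=> BD Bskew; have [x xE] := point_derivation_coord p.
exists (\matrix_(i, j) B (x i) (x j)); split.
  by apply/matrixP => i j; rewrite !mxE.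
move=> f g; rewrite (xE _ (BD f)) exchange_big; apply: eq_bigr => j _ /=.
rewrite Bskew (xE _ (BD (x j))) -sumrN mulr_suml.
by apply: eq_bigr => i _; rewrite mxE -mulNr -Bskew.
Qed.

Lemma bivector_app_near (A : M -> 'M[R]_n) (f f' g g' : M -> R) p :
  (\forall q \near p, f q = f' q) -> (\forall q \near p, g q = g' q) ->
  bivector_app A f g p = bivector_app A f' g' p.
Proof.
move=> ff' gg'; apply: eq_bigr => i _; apply: eq_bigr => j _.
by rewrite (dfun_near _ ff') (dfun_near _ gg').
Qed.

End TangentCoordinates.

(** * Symbols of the bracket *)

Section Symbols.
Context {R : realType} {n : nat} {M : manifold R n} {r : nat}.
Context {E : vector_bundle M r}.
Implicit Types (p : M) (f g : Cinf M) (X Y Z : Sec E).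

Lemma tmap_scalar i p (k : 'I_r) : tdom E i p -> scalar (fun v : E p => tmap E i p v 0 k).
Proof. by move=> ip a u v; rewrite (tmap_linear ip) !mxE. Qed.

(** Reduces vector identities to scalar ones, so that [ring] can prove identities between
    sections. *)
Lemma fiber_ext p (u v : E p) : (forall l : {scalar E p}, l u = l v) -> u = v.
Proof.
move=> uv; have [i ip] := tdom_cover E p.
apply: (can_inj (tmapK ip)); apply/rowP => k.
pose l : {scalar E p} := HB.pack (fun v : E p => tmap E i p v 0 k)
  (GRing.isLinear.Build _ _ _ _ (fun v : E p => tmap E i p v 0 k) (tmap_scalar k ip)).
exact: (uv l).
Qed.

Lemma scale_eq0 p (a : R) : (0 < r)%N -> (forall v : E p, a *: v = 0) -> a = 0.
Proof.
move=> r0 a0; have [i ip] := tdom_cover E p.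
have := congr1 (tmap E i p) (a0 (tinv E i p (const_mx 1))).
rewrite -[in RHS](scale0r (0 : E p)) !tmap_scale // tinvK // scale0r.
by move/rowP/(_ (Ordinal r0)); rewrite !mxE mulr1.
Qed.

Lemma Cinf_scale_inj f g : (0 < r)%N -> (forall X, f *: X = g *: X) -> f = g.
Proof.
move=> r0 fg; apply: Cinf_eq => p; apply/eqP; rewrite -subr_eq0; apply/eqP.
apply: (scale_eq0 (p := p) r0) => v; have [X <-] := section_through v.
by rewrite scalerBl -!SecZE fg subrr.
Qed.

Lemma scalarDE p (l : {scalar E p}) u v : l (u + v) = l u + l v.
Proof. exact: linearD. Qed.
Lemma scalarNE p (l : {scalar E p}) u : l (- u) = - l u.
Proof. exact: linearN. Qed.
Lemma scalarZE p (l : {scalar E p}) (a : R) u : l (a *: u) = a * l u.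
Proof. exact: linearZ. Qed.
Lemma scalar0E p (l : {scalar E p}) : l 0 = 0.
Proof. exact: linear0. Qed.

End Symbols.

Ltac fiber_ring := apply: fiber_ext => ?;
  rewrite ?(Sec0E, SecDE, SecNE, SecZE, Cinf0E, CinfDE, CinfNE, CinfME, Cinf_cstE,
    scalarDE, scalarNE, scalarZE, scalar0E); ring.

Ltac sec_ring := apply: Sec_eq => ?; fiber_ring.

(** For goals that follow from a known equation by a ring identity between the two differences. *)
Lemma eq_of_subr {V : zmodType} (a b c d : V) : c = d -> a - b = c - d -> a = b.
Proof. by move=> ->; rewrite subrr => /subr0_eq. Qed.

(** * Relations between the left and right symbols *)

Section BracketSymbols.
Context {R : realType} {n : nat} {M : manifold R n} {r : nat}.
Context {E : vector_bundle M r}.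
Implicit Types (p : M) (f g : Cinf M) (X Y Z : Sec E).

(** The symbol is the commutator of [D] with multiplication by a function; the Leibniz rule follows,
    and real linearity of [D] kills the constants. *)
Lemma symbol_point_derivation (D : Sec E -> Sec E) (s : Cinf M -> Cinf M) p :
  (0 < r)%N -> R_linear D -> (forall f X, D (f *: X) = f *: D X + s f *: X) ->
  point_derivation p (fun f => s f p).
Proof.
move=> r0 [DD DZ] Ds.
have sE f X : s f *: X = D (f *: X) - f *: D X by rewrite Ds addrC addKr.
split=> [f g|f g|a].
- rewrite -CinfDE; congr Cinf_fun; apply: (Cinf_scale_inj (E := E) r0) => X.
  by rewrite scalerDl !sE scalerDl DD; sec_ring.
- rewrite -[in RHS]CinfME -[X in _ + X]CinfME -CinfDE; congr Cinf_fun.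
  apply: (Cinf_scale_inj (E := E) r0) => X.
  by rewrite sE -scalerA Ds Ds; sec_ring.
- rewrite -(Cinf0E p); congr Cinf_fun; apply: (Cinf_scale_inj (E := E) r0) => X.
  by rewrite sE DZ subrr scale0r.
Qed.

Variable br : Sec E -> Sec E -> Sec E.
Hypothesis r_gt0 : (0 < r)%N.
Hypothesis br_bilinear : R_bilinear br.
Hypothesis br_jacobi : jacobi_identity br.
Variables lsym rsym : Sec E -> Cinf M -> Cinf M.
Hypothesis brZr : forall X f Y, br X (f *: Y) = f *: br X Y + lsym X f *: Y.
Hypothesis brZl : forall Y f X, br (f *: X) Y = f *: br X Y + rsym Y f *: X.

Let brDr X Y Z : br X (Y + Z) = br X Y + br X Z.
Proof. exact: (br_bilinear.1 X).1. Qed.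

Let brDl X Y Z : br (X + Y) Z = br X Z + br Y Z.
Proof. exact: (br_bilinear.2 Z).1. Qed.

(** [sym_br] and [csym] are S and c in the outline above. *)
Let sym_br X Y := br X Y + br Y X.
Let csym X f := lsym X f + rsym X f.

Let sym_brZ X f Y : sym_br X (f *: Y) = f *: sym_br X Y + csym X f *: Y.
Proof. by rewrite /sym_br brZr brZl; sec_ring. Qed.

(** The Jacobi identity gives opposite values to [[X, Y], Z] and [[Y, X], Z]. *)
Let br_sym_br X Y Z : br (sym_br X Y) Z = 0.
Proof. by rewrite /sym_br brDl !br_jacobi; sec_ring. Qed.

Let csym_br X f Y Z :
  csym X f *: br Y Z + rsym Z f *: sym_br X Y + rsym Z (csym X f) *: Y = 0.
Proof.
have := br_sym_br X (f *: Y) Z.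
rewrite sym_brZ brDl !brZl br_sym_br scaler0 add0r => <-; sec_ring.
Qed.

Let csym_rsym X f Z g : csym X f * rsym Z g + rsym Z f * csym X g = 0.
Proof.
apply: (Cinf_scale_inj (E := E) r_gt0) => Y; rewrite scale0r.
have := csym_br X f (g *: Y) Z; rewrite brZl sym_brZ => H.
(* Subtracting [g] times the relation for [Y] from the one for [g *: Y] leaves a multiple of [Y]
   alone. *)
have H' := congr2 (fun U V => U - g *: V) H (csym_br X f Y Z).
cbv beta in H'; apply: (eq_of_subr H'); sec_ring.
Qed.

Lemma rsym_lsym X f : rsym X f = - lsym X f.
Proof.
apply/eqP; rewrite -addr_eq0 addrC; apply/eqP; apply: Cinf_eq => p.
rewrite Cinf0E -/(csym X f); apply: contrapT => /eqP c_neq0.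
have rsym0 Z g : rsym Z g p = 0.
  (* The case [g = f] is twice a product, so the symbol vanishes on [f] first and then on every
     [g]. *)
  have rf : rsym Z f p = 0.
    have := congr1 (fun h : Cinf M => h p) (csym_rsym X f Z f).
    rewrite CinfDE !CinfME [_ * csym X f p]mulrC -mulr2n => /eqP.
    by rewrite mulrn_eq0 /= mulf_eq0 (negPf c_neq0) => /eqP.
  have := congr1 (fun h : Cinf M => h p) (csym_rsym X f Z g).
  rewrite CinfDE !CinfME rf mul0r addr0 => /eqP.
  by rewrite mulf_eq0 (negPf c_neq0) => /eqP.
have br0 Y Z : br Y Z p = 0.
  have := congr1 (fun S : Sec E => S p) (csym_br X f Y Z).
  rewrite !SecDE !SecZE !rsym0 !scale0r !addr0 => /eqP.
  by rewrite scaler_eq0 (negPf c_neq0) => /eqP.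
(* With all brackets zero at [p], only the symbol term is left in [brZr]. *)
have lsym0 : lsym X f p = 0.
  apply: (scale_eq0 (E := E) (p := p) r_gt0) => v; have [Y <-] := section_through v.
  have := congr1 (fun S : Sec E => S p) (brZr X f Y).
  by rewrite SecDE !SecZE !br0 scaler0 add0r => <-.
by move: c_neq0; rewrite /csym CinfDE lsym0 rsym0 addr0 eqxx.
Qed.

Lemma br_scale X Y f g : br (f *: X) (g *: Y) =
  (f * g) *: br X Y + lsym (f *: X) g *: Y - (g * lsym Y f) *: X.
Proof. by rewrite brZr brZl rsym_lsym; sec_ring. Qed.

(* Both sides come from the two ways of expanding [br (f *: X) (g *: Y)]. *)
Lemma lsym_defect X Y f g :
  (lsym (f *: X) g - f * lsym X g) *: Y = (g * lsym Y f - lsym (g *: Y) f) *: X.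
Proof.
have := br_scale X Y f g; rewrite brZl !brZr rsym_lsym => H.
apply: (eq_of_subr (esym H)); sec_ring.
Qed.

(** Since c_X = 0, the relation [csym_br] reduces to r_Z(f) S(X, Y) = 0, and the symbol can be
    cancelled at [p]. *)
Lemma sym_br_eq0 X Y Z f p : lsym Z f p != 0 -> br X Y p = - br Y X p.
Proof.
move=> a0; have c0 : csym X f = 0 by rewrite /csym rsym_lsym subrr.
have r0 : rsym Z 0 p = 0.
  have [_ _ rcst] := symbol_point_derivation p r_gt0 (br_bilinear.2 Z) (brZl Z).
  exact: (rcst 0).
have := congr1 (fun S : Sec E => S p) (csym_br X f Y Z); cbv beta.
rewrite c0 !SecDE !SecZE r0 Cinf0E !scale0r add0r addr0 rsym_lsym CinfNE => /eqP.
by rewrite Sec0E scaler_eq0 oppr_eq0 (negPf a0) /sym_br SecDE addr_eq0 => /eqP.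
Qed.

Lemma lsymD X Y f : lsym (X + Y) f = lsym X f + lsym Y f.
Proof.
apply: (Cinf_scale_inj (E := E) r_gt0) => Z.
have := brZr (X + Y) f Z; rewrite !brDl !brZr => H.
apply: (eq_of_subr (esym H)); sec_ring.
Qed.

(** Compare the Jacobi identity for [Z] with that for [f *: Z]; the terms with a single
    differentiation of [f] cancel. *)
Lemma lsym_br X Y f : lsym (br X Y) f = lsym X (lsym Y f) - lsym Y (lsym X f).
Proof.
apply: (Cinf_scale_inj (E := E) r_gt0) => Z.
have := br_jacobi X Y (f *: Z).
rewrite !brZr !brDr !brZr br_jacobi => H.
apply: (eq_of_subr H); sec_ring.
Qed.


Lemma lsym_point_derivation X p : point_derivation p (fun f => lsym X f p).
Proof.
exact: (symbol_point_derivation p r_gt0 (br_bilinear.1 X) (brZr X)).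
Qed.

(** A bump equal to 1 at [p] makes the two products equal, and the symbol terms agree because
    [Y p = Y' p]. *)
Lemma br_near_r X Y Y' p : (\forall q \near p, Y q = Y' q) -> br X Y p = br X Y' p.
Proof.
move=> /near_openP[V [oV Vp VY]].
have [phi [W [oW VW W0 /nbhs_singleton phi1]]] := bump oV Vp.
have E1 : phi *: Y = phi *: Y'.
  apply: Sec_eq => q; rewrite !SecZE.
  by have [/VY->//|/W0->] := VW q; rewrite !scale0r.
have := congr1 (fun S => br X S p) E1; cbv beta.
by rewrite !brZr !SecDE !SecZE phi1 !scale1r (VY p Vp) => /addIr.
Qed.

Lemma br_near_l X X' Y p : (\forall q \near p, X q = X' q) -> br X Y p = br X' Y p.
Proof.
move=> /near_openP[V [oV Vp VX]].
have [phi [W [oW VW W0 /nbhs_singleton phi1]]] := bump oV Vp.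
have E1 : phi *: X = phi *: X'.
  apply: Sec_eq => q; rewrite !SecZE.
  by have [/VX->//|/W0->] := VW q; rewrite !scale0r.
have := congr1 (fun S => br S Y p) E1; cbv beta.
by rewrite !brZl !SecDE !SecZE phi1 !scale1r (VX p Vp) => /addIr.
Qed.

Lemma lsym_near X X' f p : (\forall q \near p, X q = X' q) -> lsym X f p = lsym X' f p.
Proof.
move=> XX'; apply/eqP; rewrite -subr_eq0; apply/eqP.
apply: (scale_eq0 (E := E) (p := p) r_gt0) => v; have [Y <-] := section_through v.
have E1 Z : lsym Z f p *: Y p = br Z (f *: Y) p - f p *: br Z Y p.
  by rewrite brZr SecDE !SecZE addrC addKr.
by rewrite scalerBl !E1 !(br_near_l _ XX') subrr.
Qed.

(** * Rank greater than one *)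

Section HigherRank.
Hypothesis r_gt1 : (1 < r)%N.

(** If the sides differed at [p], [lsym_defect] would make every vector of the fiber a multiple of
    [X p], impossible in rank at least 2. *)
Lemma lsymZ X f g : lsym (f *: X) g = f * lsym X g.
Proof.
apply: Cinf_eq => p; rewrite CinfME; apply/eqP; rewrite -subr_eq0; apply/eqP.
set d := _ - _; apply: contrapT => /eqP d0.
have H (v : E p) : exists c : R, d *: v = c *: X p.
  have [Y <-] := section_through v.
  have := congr1 (fun S : Sec E => S p) (lsym_defect X Y f g); cbv beta.
  by rewrite !SecZE CinfDE CinfNE CinfME -/d; exists ((g * lsym Y f - lsym (g *: Y) f) p).
have [i ip] := tdom_cover E p.
have {}H (w : 'rV[R]_r) : exists c : R, d *: w = c *: tmap E i p (X p).
  have [c Hc] := H (tinv E i p w); exists c.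
  by rewrite -tmap_scale // -Hc tmap_scale // tinvK.
(* Two basis vectors suffice: were both, scaled by [d], multiples of one vector, [d] would
   vanish. *)
pose k0 := Ordinal r_gt0; pose k1 := Ordinal r_gt1.
have [c0 H0] := H (delta_mx 0 k0); have [c1 H1] := H (delta_mx 0 k1).
have := congr1 (fun w : 'rV[R]_r => w 0 k0) H0.
have := congr1 (fun w : 'rV[R]_r => w 0 k1) H0.
have := congr1 (fun w : 'rV[R]_r => w 0 k1) H1.
rewrite !mxE /= mulr1 mulr0 => E11 E01 E00.
have c00 : c0 != 0 by apply: contra_neq d0 => c00; rewrite E00 c00 mul0r.
move/esym/eqP: E01; rewrite mulf_eq0 (negPf c00) /= => /eqP u1.
by move: d0; rewrite E11 u1 mulr0 eqxx.
Qed.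

Lemma lsym_sum (I : finType) (h : I -> Sec E) f :
  lsym (\sum_i h i) f = \sum_i lsym (h i) f.
Proof.
apply: (big_morph (fun X => lsym X f)) => [X Y|]; first exact: lsymD.
by rewrite -(scale0r (0 : Sec E)) lsymZ mul0r.
Qed.

(** In a local frame the coefficients of [X] vanish at [p], and the symbol is local and linear over
    functions. *)
Lemma lsym_eq0 X f p : X p = 0 -> lsym X f p = 0.
Proof.
move=> Xp; have [i ip] := tdom_cover E p.
have [e eE] := choice (fun k : 'I_r => extend_section (tdom_open i) ip
  (smooth_section_tinv i (delta_mx 0 k))).
have sX k : smooth (tdom E i) (fun q => tmap E i q (X q) 0 k).
  move: k; apply/(smooth_coord _ (tdom_open i)).
  by apply: smoothS (Sec_smooth X i); rewrite setTI.
have [x xE] := choice (fun k : 'I_r => extend_function (tdom_open i) ip (sX k)).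
have XE : \forall q \near p, X q = (\sum_k x k *: e k) q.
  have {}eE : \forall q \near p, forall k, e k q = tinv E i q (delta_mx 0 k).
    by exact: filter_forall eE.
  have {}xE' : \forall q \near p, forall k, x k q = tmap E i q (X q) 0 k.
    by exact: filter_forall xE.
  have in_dom : \forall q \near p, tdom E i q.
    by apply: open_nbhs_nbhs; split=> //; exact: tdom_open.
  near=> q; have iq : tdom E i q by near: q.
  have -> : (\sum_k x k *: e k) q = \sum_k x k q *: e k q.
    by elim/big_rec2 : _ => // k y1 y2 _ <-.
  rewrite -[LHS](tmapK iq).
  pose L : {linear 'rV[R]_r -> E q} := HB.pack (tinv E i q)
    (GRing.isLinear.Build _ _ _ _ (tinv E i q) (tinv_linear iq)).
  have -> : tinv E i q (tmap E i q (X q)) =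
      L (\sum_k tmap E i q (X q) 0 k *: delta_mx 0 k) by rewrite -row_sum_delta.
  rewrite linear_sum; apply: eq_bigr => k _.
  by rewrite linearZ /= (near xE' q) // (near eE q).
rewrite (lsym_near _ XE) lsym_sum Cinf_sumE big1 // => k _.
rewrite lsymZ CinfME (nbhs_singleton (xE k)) Xp.
have -> : tmap E i p 0 = 0 by rewrite -(scale0r (0 : E p)) tmap_scale // scale0r.
by rewrite mxE mul0r.
Unshelve. all: by end_near. Qed.

Lemma lsym_value X Y f p : X p = Y p -> lsym X f p = lsym Y f p.
Proof.
move=> XY; have : lsym (X - Y) f p = 0.
  by apply: lsym_eq0; rewrite SecDE SecNE XY subrr.
have -> : X - Y = X + Cinf_cst (-1) *: Y by sec_ring.
rewrite lsymD lsymZ CinfDE CinfME mulN1r => /eqP.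
by rewrite subr_eq0 => /eqP.
Qed.

Lemma anchor_exists p (v : E p) : exists w : TM M p,
  forall X f, X p = v -> lsym X f p = dfun f w.
Proof.
have [X <-] := section_through v.
have [w wE] := point_derivation_tangent (lsym_point_derivation X p).
by exists w => Y f YX; rewrite -wE; exact: lsym_value.
Qed.

(** The vector is chosen, but [tangent_eq] leaves only one candidate, so its properties can be
    tested on functions. *)
Definition anchor p (v : E p) : TM M p := projT1 (cid (anchor_exists v)).

Lemma anchorE X f p : dfun f (anchor (X p)) = lsym X f p.
Proof. by rewrite /anchor; case: cid => w /= wE; rewrite -(wE X). Qed.

Lemma anchor_linear p : linear (@anchor p).
Proof.
move=> c u v; have [X Xp] := section_through u; have [Y Yp] := section_through v.
apply: tangent_eq => f.
rewrite (dfun_linear openT (Cinf_smooth f)) // -Xp -Yp !anchorE.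
have -> : c *: X p + Y p = (Cinf_cst c *: X + Y) p by [].
by rewrite anchorE lsymD lsymZ.
Qed.

Lemma anchor_smooth i j (v : 'rV[R]_r) :
  smooth (tdom E i `&` tdom (TM M) j) (fun p => tmap (TM M) j p (anchor (tinv E i p v))).
Proof.
apply: (@smooth_vector_field _ _ _ (tdom E i) (fun p => anchor (tinv E i p v))).
  exact: tdom_open.
move=> p ip.
have [X XE] := extend_section (tdom_open i) ip (smooth_section_tinv i v).
by exists (lsym X); move: XE; apply: filterS => q <- f; rewrite anchorE.
Qed.

Definition anchor_morphism : bundle_morphism E (TM M) :=
  @BundleMorphism R n M r n E (TM M)
    (fun p => HB.pack (@anchor p)
       (GRing.isLinear.Build _ _ _ _ (@anchor p) (@anchor_linear p)))
    anchor_smooth.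

Lemma vf_app_anchor X f : vf_app (bm_app anchor_morphism X) f = lsym X f.
Proof. by apply: Cinf_eq => p; exact: anchorE. Qed.

Lemma higher_rank_anchor : exists a : bundle_morphism E (TM M),
  [/\ forall X Y : Sec E,
        is_vf_bracket (bm_app a X) (bm_app a Y) (bm_app a (br X Y)),
      forall (X Y : Sec E) (f g : Cinf M),
        br (f *: X) (g *: Y) =
          (f * g) *: br X Y + (f * vf_app (bm_app a X) g) *: Y
          - (g * vf_app (bm_app a Y) f) *: X
    & forall (X Y : Sec E) (p : M),
        (exists v : E p, a p v <> 0) -> br X Y p = - br Y X p].
Proof.
exists anchor_morphism; split.
- by move=> X Y f; rewrite !vf_app_anchor lsym_br.
- by move=> X Y f g; rewrite br_scale !vf_app_anchor lsymZ.
- move=> X Y p [v v0]; have [Z Zp] := section_through v.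
  (* A nonzero tangent vector has a nonzero derivative on some function. *)
  have [f f0] : exists f, lsym Z f p != 0.
    apply: contrapT => nex; apply: v0 => /=; apply: tangent_eq => f.
    rewrite -Zp anchorE -[in RHS](scale0r (0 : TM M p)) -[_ *: _]addr0.
    rewrite (dfun_linear openT (Cinf_smooth f)) // mul0r add0r.
    have -> : dfun f (0 : TM M p) = 0.
      have := dfun_linear openT (Cinf_smooth f) (I : setT p) (-1) (0 : TM M p) 0.
      by rewrite scaler0 addr0 mulN1r addNr.
    by apply: contrapT => /eqP H; apply: nex; exists f.
  exact: sym_br_eq0 f0.
Qed.

End HigherRank.

(** * Rank one *)

Section LineTrivialization.
Variables (U : set M) (t : forall p, E p -> R).
Hypothesis tU : line_trivialization U t.

Let oU : open U. Proof. by case: tU. Qed.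

Let tD p (u v : E p) : U p -> t (u + v) = t u + t v.
Proof.
case: tU => _ tl _ _ Up.
by have := tl p Up 1 u v; rewrite scale1r mul1r.
Qed.

Let tZ p a (v : E p) : U p -> t (a *: v) = a * t v.
Proof.
case: tU => _ tl _ _ Up; have t0 : t (0 : E p) = 0.
  by have := tl p Up (-1) 0 0; rewrite scaler0 addr0 mulN1r addNr.
by have := tl p Up a v 0; rewrite !addr0 t0 addr0.
Qed.

Let t_inj p : U p -> injective (@t p).
Proof. by case: tU => _ _ tb _ Up; exact: bij_inj (tb p Up). Qed.

Let t_sum p (I : finType) (h : I -> E p) : U p -> t (\sum_i h i) = \sum_i t (h i).
Proof.
move=> Up; apply: (big_morph (@t p)) => [u v|]; first exact: tD.
by rewrite -(scale0r (0 : E p)) tZ // mul0r.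
Qed.

(** A nonzero constant section of a bundle trivialization is divided by its [t]-coordinate. *)
Lemma line_frame p : U p -> exists e : Sec E, \forall q \near p, t (e q) = 1.
Proof.
move=> Up; have [i ip] := tdom_cover E p; have [_ _ _ ts] := tU.
pose tau q := t (tinv E i q (const_mx 1)).
pose V := U `&` tdom E i; have oV : open V by apply: openI => //; exact: tdom_open.
have tau0 q : V q -> tau q != 0.
  move=> [Uq iq]; apply/eqP => tq0.
  have : tinv E i q (const_mx 1) = 0.
    by apply: (t_inj Uq); rewrite -/(tau q) tq0 -(scale0r (0 : E q)) tZ // mul0r.
  move/(congr1 (tmap E i q)); rewrite tinvK // -(scale0r (0 : E q)) tmap_scale // scale0r.
  by move/rowP/(_ (Ordinal r_gt0)); rewrite !mxE => /eqP; rewrite oner_eq0.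
have sV : smooth_section V (fun q => (tau q)^-1 *: tinv E i q (const_mx 1)).
  apply: smooth_section_scale => //; first by apply: smooth_inv => //; exact: ts.
  by move=> j; apply: smoothS (triv_transition i j (const_mx 1)) => q [[]].
have Vp : V p by [].
have [e eE] := extend_section oV Vp sV; exists e.
have nV : \forall q \near p, V q by exact: open_nbhs_nbhs.
by move: eE nV; apply: filterS2 => q -> Vq; rewrite tZ ?mulVf ?tau0 //; case: Vq.
Qed.

Lemma line_section_smooth (X : Sec E) : smooth U (fun q => t (X q)).
Proof.
apply: smooth_local => p Up; have [i ip] := tdom_cover E p; have [_ _ _ ts] := tU.
pose V := U `&` tdom E i; have oV : open V by apply: openI => //; exact: tdom_open.
exists V; first by [].
pose g k q := tmap E i q (X q) 0 k * t (tinv E i q (delta_mx 0 k)).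
have sg : smooth V (fun q => \sum_k g k q).
  apply: smooth_sum => // k; apply: smooth_mul => //; last exact: ts.
  move: k {g}; apply/(smooth_coord _ oV).
  by apply: smoothS (Sec_smooth X i) => q [].
apply: (smooth_congr oV _ sg) => q [Uq iq].
rewrite -[in RHS](tmapK iq (X q)).
pose L : {linear 'rV[R]_r -> E q} := HB.pack (tinv E i q)
  (GRing.isLinear.Build _ _ _ _ (tinv E i q) (tinv_linear iq)).
have -> : tinv E i q (tmap E i q (X q)) =
    L (\sum_k tmap E i q (X q) 0 k *: delta_mx 0 k) by rewrite -row_sum_delta.
by rewrite linear_sum t_sum //; apply: eq_bigr => k _; rewrite linearZ tZ.
Qed.

Let near_U p : U p -> \forall q \near p, U q.
Proof. by move=> Up; exact: open_nbhs_nbhs. Qed.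

Lemma line_coefficient (e X : Sec E) p : U p -> (\forall q \near p, t (e q) = 1) ->
  exists F : Cinf M, (\forall q \near p, F q = t (X q)) /\
    \forall q \near p, X q = (F *: e) q.
Proof.
move=> Up e1; have [F FE] := extend_function oU Up (line_section_smooth X).
exists F; split=> //; move: FE e1 (near_U Up); apply: filterS3 => q FE e1 Uq.
by apply: (t_inj Uq); rewrite SecZE tZ // e1 mulr1.
Qed.

(* Where all symbols vanish at [p], a frame [e] has [br e e = w *: e], and
   [br (br e e) e = 0] becomes [w p ^+ 2 = 0]. *)
Lemma line_skew X Y p : U p -> br X Y p = - br Y X p.
Proof.
move=> Up; have [[Z [f Zf]]|nZ] := pselect (exists Z f, lsym Z f p != 0).
  exact: sym_br_eq0 Zf.
have l0 Z f : lsym Z f p = 0.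
  by apply: contrapT => /eqP Zf; apply: nZ; exists Z, f.
have [e e1] := line_frame Up.
have ee0 : br e e p = 0.
  have [w [wE eeE]] := line_coefficient (br e e) Up e1.
  have := congr1 (fun S : Sec E => S p) (br_sym_br e e e); cbv beta.
  rewrite /sym_br brDl SecDE (br_near_l _ eeE) brZl SecDE !SecZE.
  rewrite rsym_lsym CinfNE l0 oppr0 scale0r addr0 Sec0E -mulr2n => /eqP.
  rewrite -scaler_nat scaler_eq0 pnatr_eq0 /= scaler_eq0 => /orP[/eqP w0|/eqP//].
  by rewrite (nbhs_singleton eeE) SecZE w0 scale0r.
(* Every term of [br_scale] contains [br e e] or a symbol, and both vanish at [p]. *)
have br0 X' Y' : br X' Y' p = 0.
  have [F [_ FE]] := line_coefficient X' Up e1.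
  have [G [_ GE]] := line_coefficient Y' Up e1.
  rewrite (br_near_l _ FE) (br_near_r _ GE) br_scale.
  by rewrite !SecDE SecNE !SecZE !CinfME ee0 !l0 mulr0 !scale0r scaler0 subr0 addr0.
by rewrite !br0 oppr0.
Qed.

(* In the frame [e] this is the bivector of the Jacobi bracket. *)
Let lam (e : Sec E) f g := lsym (f *: e) g - f * lsym e g.

(** The case [X = Y = e] of [lsym_defect], with the nonzero vector [e p] cancelled. *)
Let lam_skew (e : Sec E) f g p : e p != 0 -> lam e f g p = - lam e g f p.
Proof.
move=> e0; have := congr1 (fun S : Sec E => S p) (lsym_defect e e f g); cbv beta.
rewrite !SecZE => /eqP; rewrite -subr_eq0 -scalerBl scaler_eq0 (negPf e0) orbF subr_eq0.
by move=> /eqP; rewrite /lam => ->; rewrite !CinfDE !CinfNE opprB addrC.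
Qed.

Let lam_point_derivation (e : Sec E) f p : point_derivation p (fun g => lam e f g p).
Proof.
have [D1 M1 c1] := lsym_point_derivation (f *: e) p.
have [D2 M2 c2] := lsym_point_derivation e p.
split=> [g h|g h|a]; rewrite /lam !CinfDE !CinfNE !CinfME.
- by rewrite D1 D2; ring.
- by rewrite M1 M2; ring.
- by rewrite c1 c2 mulr0 subrr.
Qed.

Let line_frames : exists e : M -> Sec E, forall p, U p -> \forall q \near p, t (e p q) = 1.
Proof.
have H p : exists e : Sec E, U p -> \forall q \near p, t (e q) = 1.
  (* The zero section is a default value outside [U]. *)
  have [Up|nUp] := pselect (U p); last by exists 0.
  by have [e e1] := line_frame Up; exists e.
by have [e He] := choice H; exists e.
Qed.

Let frame_neq0 (e : Sec E) p : U p -> (\forall q \near p, t (e q) = 1) -> e p != 0.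
Proof.
move=> Up /nbhs_singleton e1; apply/eqP => e0; move: e1.
rewrite e0 -(scale0r (0 : E p)) tZ // mul0r => /eqP.
by rewrite eq_sym oner_eq0.
Qed.

Let line_bivectors (e : M -> Sec E) :
    (forall p, U p -> \forall q \near p, t (e p q) = 1) ->
  exists A : M -> 'M[R]_n, forall p, U p -> (A p)^T = - A p /\ forall f g : Cinf M,
    lam (e p) f g p = bivector_app A f g p.
Proof.
move=> e1; pose P p (B : 'M[R]_n) := U p -> B^T = - B /\ forall f g : Cinf M,
    lam (e p) f g p = bivector_app (fun=> B) f g p.
have [p|A AP] := @choice _ _ P; last by exists A => p /AP.
have [Up|nUp] := pselect (U p); last by exists 0.
have [B HB] := biderivation_matrix (fun f => lam_point_derivation (e p) f p)
  (fun f g => lam_skew f g (frame_neq0 Up (e1 p Up))).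
by exists B.
Qed.

Let line_vectors (e : M -> Sec E) : exists G : forall p, TM M p,
  forall p (f : Cinf M), lsym (e p) f p = dfun f (G p).
Proof.
have H p := point_derivation_tangent (lsym_point_derivation (e p) p).
by exists (fun p => projT1 (cid (H p))) => p f; case: cid.
Qed.

Lemma line_lift (f : M -> R) p : U p -> smooth U f ->
  exists X : Sec E, \forall q \near p, f q = t (X q).
Proof.
move=> Up sf; have [e e1] := line_frame Up.
have [F FE] := extend_function oU Up sf.
exists (F *: e); move: FE e1 (near_U Up); apply: filterS3 => q FE e1 Uq.
by rewrite SecZE tZ // e1 mulr1.
Qed.

(** Frames are chosen separately at each point, but injectivity of [t] makes nearby choices agree as
    germs; smoothness of the bivector and of the vector field rests on this. *)
Let frames_near (e : M -> Sec E) :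
    (forall p, U p -> \forall q \near p, t (e p q) = 1) ->
  forall p, U p -> \forall q \near p, \forall z \near q, e q z = e p z.
Proof.
move=> e1 p Up; have [V [oV Vp VE]] := near_openP (e1 p Up).
apply: (@near_open _ (V `&` U)) => //; first exact: openI.
move=> q [Vq Uq]; have := near_open oV Vq VE.
move: (e1 q Uq) (near_U Uq); apply: filterS3 => z ez Uz ez'.
by apply: (t_inj Uz); rewrite ez ez'.
Qed.

Lemma line_jacobi_bracket : exists b : (M -> R) -> (M -> R) -> M -> R,
  jacobi_bracket U b /\
  forall (V : set M) (f g : M -> R) (X Y : Sec E),
    open V -> V `<=` U -> smooth U f -> smooth U g ->
    (forall p, V p -> f p = t (X p)) -> (forall p, V p -> g p = t (Y p)) ->
    forall p, V p -> b f g p = t (br X Y p).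
Proof.
have [e e1] := line_frames.
have [A AE] := line_bivectors e1; have [G GE] := line_vectors e.
have e_near := frames_near e1.
have [b bA] : exists b : (M -> R) -> (M -> R) -> M -> R, forall (f g : M -> R) p,
    b f g p = bivector_app A f g p + f p * dfun g (G p) - g p * dfun f (G p).
  by exists (fun (f g : M -> R) p =>
    bivector_app A f g p + f p * dfun g (G p) - g p * dfun f (G p)).
(* Only germs at [p] matter, so any local lifts of the functions to sections may be used. *)
have bE p (f g : M -> R) X Y : U p -> (\forall q \near p, f q = t (X q)) ->
    (\forall q \near p, g q = t (Y q)) -> b f g p = t (br X Y p).
  move=> Up fX gY.
  have [F [Ft XF]] := line_coefficient X Up (e1 p Up).
  have [H [Ht YH]] := line_coefficient Y Up (e1 p Up).
  have fF : \forall q \near p, f q = F q by move: fX Ft; apply: filterS2 => q -> ->.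
  have gH : \forall q \near p, g q = H q by move: gY Ht; apply: filterS2 => q -> ->.
  rewrite (br_near_l _ XF) (br_near_r _ YH) br_scale bA.
  rewrite (bivector_app_near A fF gH) (dfun_near _ fF) (dfun_near _ gH).
  rewrite (nbhs_singleton fF) (nbhs_singleton gH) -(AE p Up).2 -!GE /lam.
  rewrite !SecDE SecNE !SecZE !CinfME.
  have -> : br (e p) (e p) p = 0.
    have := line_skew (e p) (e p) Up => /eqP; rewrite -addr_eq0 -mulr2n.
    by rewrite -scaler_nat scaler_eq0 pnatr_eq0 /= => /eqP.
  rewrite scaler0 add0r -scalerBl tZ // (nbhs_singleton (e1 p Up)).
  by rewrite CinfDE CinfNE CinfME; ring.
exists b; split; last first.
  move=> V f g X Y oV VU sf sg fX gY p Vp.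
  exact: (bE p f g X Y (VU _ Vp) (near_open oV Vp fX) (near_open oV Vp gY)).
split.
  exists A, G; split=> //.
    split=> [p Up|c i j]; first exact: (AE p Up).1.
    apply: smooth_local => p [Up cp].
    have [x xE] := extend_coordinates cp.
    have [V [oV Vp VE]] := near_openP xE.
    have [W [oW Wp WE]] := near_openP (e_near p Up).
    have oO : open (V `&` W `&` U) by apply: openI => //; exact: openI.
    exists (V `&` W `&` U); first by [].
    (* The single frame chosen at [p] serves the whole neighbourhood, so the component is a global
       smooth function restricted to it. *)
    have sl : smooth (V `&` W `&` U) (lam (e p) (x i) (x j)).
      by apply: smoothS (Cinf_smooth (lam (e p) (x i) (x j))).
    apply: (smooth_congr oO _ sl) => q [[Vq Wq] Uq].
    have xq k : \forall z \near q, chart_coord c k z = x k z.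
      by apply: (near_open oV Vq) => z Vz; rewrite VE.
    rewrite (bivector_app_near A (xq i) (xq j)) -(AE q Uq).2 /lam.
    rewrite !CinfDE !CinfNE !CinfME; congr (_ - _ * _); apply: lsym_near.
      by have := WE q Wq; apply: filterS => z ez; rewrite !SecZE ez.
    by have := WE q Wq; apply: filterS => z ez; rewrite ez.
  apply: smooth_vector_field => // p Up; exists (lsym (e p)).
  have := e_near p Up; apply: filterS => q eq f; rewrite -GE; apply: lsym_near.
  by move: eq; apply: filterS => z ->.
move=> f g h sf sg sh p Up.
have [X fX] := line_lift Up sf; have [Y gY] := line_lift Up sg.
have [Z hZ] := line_lift Up sh.
(* For nested brackets the inner comparison must hold on a neighbourhood of [p]. *)
have bnear (f1 g1 : M -> R) X1 Y1 : (\forall q \near p, f1 q = t (X1 q)) ->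
    (\forall q \near p, g1 q = t (Y1 q)) ->
    \forall q \near p, b f1 g1 q = t (br X1 Y1 q).
  move=> /near_openP[V [oV Vp VE]] /near_openP[W [oW Wp WE]].
  apply: (@near_open _ (V `&` W `&` U)) => //; first by apply: openI => //; exact: openI.
  move=> q [[Vq Wq] Uq].
  exact: (bE q f1 g1 X1 Y1 Uq (near_open oV Vq VE) (near_open oW Wq WE)).
rewrite (bE p _ _ _ _ Up (bnear _ _ _ _ fX gY) hZ).
rewrite (bE p _ _ _ _ Up fX (bnear _ _ _ _ gY hZ)).
rewrite (bE p _ _ _ _ Up gY (bnear _ _ _ _ fX hZ)).
by rewrite br_jacobi SecDE SecNE tD // -scaleN1r tZ // mulN1r.
Qed.

End LineTrivialization.

(** Off its support a section vanishes on a neighbourhood, and the bracket depends only on germs. *)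
Lemma br_support X Y : supp (br X Y) `<=` supp X `&` supp Y.
Proof.
have near0 (Z : Sec E) p : ~ supp Z p -> \forall q \near p, Z q = (0 : Sec E) q.
  move=> nZ; have oC : open (~` supp Z) by apply: closed_openC; exact: closed_closure.
  apply: (near_open oC nZ) => q nq; apply: contrapT => Zq.
  by apply: nq; exact: subset_closure.
have br0r X' : br X' 0 = 0.
  by apply: (addrI (br X' 0)); rewrite -brDr !addr0.
have br0l X' : br 0 X' = 0.
  by apply: (addrI (br 0 X')); rewrite -brDl !addr0.
have sub Z : (forall p, ~ supp Z p -> br X Y p = 0) -> supp (br X Y) `<=` supp Z.
  move=> H; rewrite [X in _ `<=` X](closure_id _).1; last exact: closed_closure.
  apply: closureS => p brp; apply: contrapT => /H; exact: brp.
rewrite subsetI; split; apply: sub => p nZ.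
  by rewrite (br_near_l _ (near0 _ _ nZ)) br0l.
by rewrite (br_near_r _ (near0 _ _ nZ)) br0r.
Qed.

(** Skew-symmetry is checked pointwise, over the domain of a bundle trivialization, whose only
    coordinate is a line trivialization. *)
Lemma line_bundle_jacobi : r = 1%N ->
  [/\ skew_symmetric br, local_lie_algebra br & locally_jacobi br].
Proof.
move=> r1; have lE i : line_trivialization (tdom E i)
    (fun p (v : E p) => tmap E i p v 0 (Ordinal r_gt0)).
  split; first exact: tdom_open.
  - by move=> p ip a u v; rewrite (tmap_linear ip) !mxE.
  - move=> p ip; exists (fun a => tinv E i p (const_mx a)).
      move=> v; apply: (can_inj (tmapK ip)); rewrite tinvK //; apply/rowP => k.
      rewrite mxE; congr (tmap E i p v 0 _); apply: val_inj => /=.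
      by have := ltn_ord k; rewrite {2}r1 ltnS leqn0 => /eqP.
    by move=> a; rewrite tinvK // mxE.
  - move=> j v; move: (Ordinal r_gt0).
    have oij : open (tdom E i `&` tdom E j) by apply: openI; exact: tdom_open.
    apply/(smooth_coord _ oij).
    by apply: smoothS (triv_transition j i v) => q [].
have skew : skew_symmetric br.
  move=> X Y; apply: Sec_eq => p; rewrite SecNE; have [i ip] := tdom_cover E p.
  exact: (line_skew (lE i)).
split=> //; first by split=> // X Y; exact: br_support.
by move=> U t tU; exact: line_jacobi_bracket.
Qed.

End BracketSymbols.

(** * Choice of the symbols, and the two cases together *)

Lemma quasi_derivation_symbol {R : realType} {n : nat} {M : manifold R n} {r : nat}
    {E : vector_bundle M r} (D : Sec E -> Sec E -> Sec E) :
  (forall X, quasi_derivation (D X)) ->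
  exists s : Sec E -> Cinf M -> Cinf M,
    forall X f Y, D X (f *: Y) = f *: D X Y + s X f *: Y.
Proof.
move=> qD; exists (fun X => projT1 (choice (qD X).2)) => X.
exact: (projT2 (choice (qD X).2)).
Qed.

Theorem theorem6 (R : realType) (n : nat) (M : manifold R n) (r : nat)
    (E : vector_bundle M r) (br : Sec E -> Sec E -> Sec E) :
  R_bilinear br ->
  jacobi_identity br ->
  (forall X : Sec E, quasi_derivation (br X)) ->
  (forall X : Sec E, quasi_derivation (br^~ X)) ->
  ((1 < r)%N ->
     exists a : bundle_morphism E (TM M),
       [/\ forall X Y : Sec E,
             is_vf_bracket (bm_app a X) (bm_app a Y) (bm_app a (br X Y)),
           forall (X Y : Sec E) (f g : Cinf M),
             br (f *: X) (g *: Y) =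
               (f * g) *: br X Y + (f * vf_app (bm_app a X) g) *: Y
               - (g * vf_app (bm_app a Y) f) *: X
         & forall (X Y : Sec E) (p : M),
             (exists v : E p, a p v <> 0) -> br X Y p = - br Y X p]) /\
  (r = 1%N ->
     [/\ skew_symmetric br, local_lie_algebra br & locally_jacobi br]).
Proof.
move=> bil jac qdl qdr.
have [lsym brZr] := quasi_derivation_symbol (D := br) qdl.
have [rsym brZl] := quasi_derivation_symbol (D := fun Y X => br X Y) qdr.
split=> [r1|r1].
  have r0 : (0 < r)%N := ltnW r1.
  exact: (higher_rank_anchor r0 bil jac brZr brZl r1).
have r0 : (0 < r)%N by rewrite r1.
exact: (line_bundle_jacobi r0 bil jac brZr brZl r1).
Qed.
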